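(* For every integer $n\ge 2$, the composition $\Psi\circ\Phi$ is a bijection between well-labelled Motzkin paths of size $n$ and matchings on $[2n-2]$. For every integer $n\ge1$, the composition $\Psi'\circ\Phi'$ is a bijection between well-labelled positive paths of size $n$ and matchings on $[2n]$.
   Context: A matching on $[2m]$ is a fixed-point-free involution of $\{1,\ldots,2m\}$. Well-labelled paths: a pair $(\mathbf{p},\sigma)$ with $\mathbf{p}=p_1\ldots p_{n-1}$ a word on $\{-1,0,+1\}$, $\sigma$ a permutation of $[n]$, $p_i=-1\Rightarrow\sigma_i<\sigma_{i+1}$, $p_i=1\Rightarrow\sigma_i>\sigma_{i+1}$; Motzkin if $\sum_{i\le j}p_i\ge0$ for $j\le n-2$ and $\sum_{i\le n-1}p_i=-1$; positive if $\sum_{i\le j}p_i\ge0$ for $j\le n-1$. A labelled binary tree of size $n$: rooted tree with $n$ leaves with distinct labels in $[n]$, unlabelled internal vertices each with two unordered children; a marked one has one marked vertex. $\lambda_I$ is the order-preserving bijection $[|I|]\to I$, and $\lambda(\tau)$ relabels leaves by $\lambda$. $\Phi$ (Motzkin paths of size $n\ge2$ to trees): $n=2$ gives a root with leaves $1,2$; for $n>2$, $p_1=0$: $\Phi$ is a root with subtrees a leaf $\sigma_1$ and $\lambda_{[n]\setminus\{\sigma_1\}}(\Phi(p_2\ldots p_{n-1},\sigma'))$ where $\sigma'_i=\lambda^{-1}_{[n]\setminus\{\sigma_1\}}(\sigma_{i+1})$; for $n>2$, $p_1=1$: with $k$ least such that $\sum_{i\le k}p_i=0$, $\Phi$ is a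 root with subtrees $\lambda_{I'}(\Phi(\mathbf{p}',\sigma'))$, $\lambda_{I''}(\Phi(\mathbf{p}'',\sigma''))$, where $I'=\{\sigma_1,\ldots,\sigma_k\}$, $I''=\{\sigma_{k+1},\ldots,\sigma_n\}$, $p'_i=-p_{k-i}$, $p''_i=p_{k+i}$, $\sigma'_i=\lambda^{-1}_{I'}(\sigma_{k+1-i})$, $\sigma''_i=\lambda^{-1}_{I''}(\sigma_{k+i})$. $\Phi'$ (positive paths to marked trees): $n=1$ gives a single marked leaf $1$; $n>1$, $p_1=0$: non-marked root with subtrees a non-marked leaf $\sigma_1$ and $\lambda_{[n]\setminus\{\sigma_1\}}(\Phi'(p_2\ldots p_{n-1},\sigma'))$; $n>1$, $p_1=1$: let $k$ be the greatest $k\le n$ with $\sum_{i=1}^{j-1}p_i\ge1$ for $j=2,\ldots,k-1$ and $\sum_{i=1}^{k-1}p_i=1$, with $I',I'',\mathbf{p}',\mathbf{p}'',\sigma',\sigma''$ as before for this $k$; if $k=n$, $\Phi'$ is $\Phi(\mathbf{p}',\sigma')$ with root marked; if $k<n$, it is a non-marked root with subtrees $\lambda_{I'}(\Phi(\mathbf{p}',\sigma'))$ (non-marked) and $\lambda_{I''}(\Phi'(\mathbf{p}'',\sigma''))$ (marked). $\Psi$ (trees of size $n$ to matchings on $[2n-2]$): label the $n-2$ internal non-root vertices: while unlabelled non-root vertices exist, among those whose two children are both labelled, pick the one having the child with the least label, and give it the least label in $[2n-2]\setminus[n]$ not yet used. Then $\Psi(\tau)$ is the matching pairing $i$ and $j$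 whenever they label two siblings. $\Psi'$ (marked trees of size $n$ to matchings on $[2n]$): let $\tau$ be the unmarked tree and $\pi=\Psi(\tau)$ (with the full labelling above). If the marked vertex is the root, $\pi'$ agrees with $\pi$ on $[2n-2]$ and pairs $2n-1$ with $2n$. Otherwise, if the marked vertex has label $k$ and its sibling label $l$, $\pi'$ agrees with $\pi$ off $\{k,l\}$, and $\pi'(k)=2n$, $\pi'(l)=2n-1$. *)

(* Defs.v *)
From mathcomp Require Import all_boot all_algebra.
Set Implicit Arguments. Unset Strict Implicit. Unset Printing Implicit Defensive.
Import GRing.Theory Num.Theory.

Local Open Scope ring_scope.

(* ---------- Matchings on [k] = {1,...,k} ----------
   Element i of [k] is represented by the ordinal (i-1 : 'I_k). *)
Definition is_matching (k : nat) (f : {ffun 'I_k -> 'I_k}) : bool :=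
  [forall i, (f (f i) == i) && (f i != i)].

(* ---------- Well-labelled paths ----------
   p = p_1 ... p_{n-1} is stored as a seq int (p_i = nth 0 p (i-1)),
   sigma = sigma_1 ... sigma_n as a seq nat (sigma_i = nth 0 s (i-1)). *)
Definition step_ok (x : int) : bool := [|| x == -1, x == 0 | x == 1].

Definition psum (p : seq int) (j : nat) : int := \sum_(x <- take j p) x.

Definition well_labelled (n : nat) (p : seq int) (s : seq nat) : bool :=
  [&& size p == n.-1, all step_ok p, perm_eq s (iota 1 n) &
   all (fun i => ((nth 0 p i == -1) ==> (nth 0%N s i < nth 0%N s i.+1)%N) &&
                 ((nth 0 p i == 1) ==> (nth 0%N s i.+1 < nth 0%N s i)%N))
       (iota 0 n.-1)].

Definition motzkin (n : nat) (p : seq int) : bool :=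
  all (fun j => 0 <= psum p j) (iota 1 (n - 2)) && (psum p n.-1 == -1).

Definition positive_path (n : nat) (p : seq int) : bool :=
  all (fun j => 0 <= psum p j) (iota 1 n.-1).

Definition wl_motzkin (n : nat) (x : seq int * seq nat) : Prop :=
  well_labelled n x.1 x.2 /\ motzkin n x.1.

Definition wl_positive (n : nat) (x : seq int * seq nat) : Prop :=
  well_labelled n x.1 x.2 /\ positive_path n x.1.

Definition lam (I : seq nat) (j : nat) : nat := nth 0%N (sort leq I) j.-1.
Definition laminv (I : seq nat) (x : nat) : nat := (index x (sort leq I)).+1.

(* ---------- labelled binary trees (possibly with marks) ----------
   Each vertex carries a mark bit; unmarked trees have all bits false.
   Children are stored in an order, but everything below (Psi, Psi') is
   invariant under swapping children, so this represents unordered trees. *)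
Inductive tree : Type :=
  | Lf of bool & nat
  | Nd of bool & tree & tree.

Fixpoint relabel (f : nat -> nat) (t : tree) : tree :=
  match t with
  | Lf m l => Lf m (f l)
  | Nd m a b => Nd m (relabel f a) (relabel f b)
  end.

Definition setmark (t : tree) : tree :=
  match t with Lf _ l => Lf true l | Nd _ a b => Nd true a b end.

Fixpoint nleaves (t : tree) : nat :=
  match t with Lf _ _ => 1%N | Nd _ a b => (nleaves a + nleaves b)%N end.

Definition kmin (p : seq int) : nat :=
  (find (fun j => psum p j == 0) (iota 1 (size p))).+1.

Fixpoint Phi_f (fuel : nat) (p : seq int) (s : seq nat) : tree :=
  match fuel with
  | 0%N => Lf false 0
  | fuel'.+1 =>
    let n := size s in
    if (n <= 2)%N then Nd false (Lf false 1) (Lf false 2) else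
    match p with
    | [::] => Lf false 0
    | x :: p2 =>
      if x == 0 then
        let J := rem (head 0%N s) (iota 1 n) in
        Nd false (Lf false (head 0%N s))
           (relabel (lam J) (Phi_f fuel' p2 (map (laminv J) (behead s))))
      else
        let k := kmin p in
        let I1 := take k s in
        let I2 := drop k s in
        let p1 := map (fun y => - y) (rev (take k.-1 p)) in
        let p2 := drop k p in
        let s1 := map (laminv I1) (rev I1) in
        let s2 := map (laminv I2) I2 in
        Nd false (relabel (lam I1) (Phi_f fuel' p1 s1))
                 (relabel (lam I2) (Phi_f fuel' p2 s2))
    end
  end.

Definition Phi (p : seq int) (s : seq nat) : tree := Phi_f (size s) p s.

Definition kmax_cond (p : seq int) (k : nat) : bool :=
  all (fun j => 1 <= psum p j.-1) (iota 2 (k - 2)) && (psum p k.-1 == 1).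
Definition kmax (n : nat) (p : seq int) : nat :=
  last 0%N [seq k <- iota 2 n.-1 | kmax_cond p k].

Fixpoint Phi'_f (fuel : nat) (p : seq int) (s : seq nat) : tree :=
  match fuel with
  | 0%N => Lf true 0
  | fuel'.+1 =>
    let n := size s in
    if (n <= 1)%N then Lf true 1 else
    match p with
    | [::] => Lf true 0
    | x :: p2 =>
      if x == 0 then
        let J := rem (head 0%N s) (iota 1 n) in
        Nd false (Lf false (head 0%N s))
           (relabel (lam J) (Phi'_f fuel' p2 (map (laminv J) (behead s))))
      else
        let k := kmax n p in
        let I1 := take k s in
        let I2 := drop k s in
        let p1 := map (fun y => - y) (rev (take k.-1 p)) in
        let p2 := drop k p in
        let s1 := map (laminv I1) (rev I1) in
        let s2 := map (laminv I2) I2 in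
        if k == n then setmark (Phi p1 s1)
        else Nd false (relabel (lam I1) (Phi p1 s1))
                      (relabel (lam I2) (Phi'_f fuel' p2 s2))
    end
  end.

Definition Phi' (p : seq int) (s : seq nat) : tree := Phi'_f (size s) p s.

Inductive ltree : Type :=
  | LLf of bool & nat
  | LNd of bool & option nat & ltree & ltree.

Fixpoint to_l (t : tree) : ltree :=
  match t with Lf m l => LLf m l | Nd m a b => LNd m None (to_l a) (to_l b) end.

Definition labof (t : ltree) : option nat :=
  match t with LLf _ l => Some l | LNd _ o _ _ => o end.
Definition lab (t : ltree) : nat := odflt 0%N (labof t).
Definition markof (t : ltree) : bool :=
  match t with LLf m _ => m | LNd m _ _ _ => m end.

Definition keyof (t : ltree) : option nat :=
  match t with
  | LNd _ None a b =>
      match labof a, labof b with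
      | Some x, Some y => Some (minn x y)
      | _, _ => None
      end
  | _ => None
  end.

Fixpoint rk (t : ltree) : seq nat :=
  match t with
  | LLf _ _ => [::]
  | LNd _ _ a b =>
      (if keyof t is Some x then [:: x] else [::]) ++ rk a ++ rk b
  end.

Fixpoint assign (key c : nat) (t : ltree) : ltree :=
  match t with
  | LLf _ _ => t
  | LNd m o a b =>
      if keyof t == Some key then LNd m (Some c) a b
      else LNd m o (assign key c a) (assign key c b)
  end.

Fixpoint lab_iter (fuel c : nat) (t : ltree) : ltree :=
  match fuel with
  | 0%N => t
  | f.+1 =>
    match t with
    | LLf _ _ => t
    | LNd m o a b =>
      let ks := rk a ++ rk b in
      if ks is k0 :: _ then
        let key := foldr minn k0 ks in
        lab_iter f c.+1 (LNd m o (assign key c a) (assign key c b))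
      else t
    end
  end.

Definition label_tree (t : tree) : ltree :=
  lab_iter (nleaves t) (nleaves t).+1 (to_l t).

Fixpoint sib_pairs (t : ltree) : seq (nat * nat) :=
  match t with
  | LLf _ _ => [::]
  | LNd _ _ a b => (lab a, lab b) :: (sib_pairs a ++ sib_pairs b)
  end.

Definition partner (ps : seq (nat * nat)) (x : nat) : nat :=
  foldr (fun pr acc => if pr.1 == x then pr.2 else if pr.2 == x then pr.1 else acc)
        x ps.

Definition matching_of (k : nat) (ps : seq (nat * nat)) : {ffun 'I_k -> 'I_k} :=
  [ffun i : 'I_k => insubd i (partner ps i.+1).-1].

Definition Psi_pairs (t : tree) : seq (nat * nat) := sib_pairs (label_tree t).

Fixpoint marked_sib (t : ltree) : option (nat * nat) :=
  match t with
  | LLf _ _ => None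
  | LNd _ _ a b =>
      if markof a then Some (lab a, lab b)
      else if markof b then Some (lab b, lab a)
      else match marked_sib a with
           | Some x => Some x
           | None => marked_sib b
           end
  end.

Definition Psi'_pairs (t : tree) : seq (nat * nat) :=
  let lt := label_tree t in
  let n := nleaves t in
  let ps := sib_pairs lt in
  if markof lt then rcons ps ((2 * n).-1, (2 * n)%N)
  else match marked_sib lt with
       | Some (k, l) =>
           [seq pr <- ps | ~~ ((pr.1 == k) || (pr.2 == k))]
             ++ [:: (k, (2 * n)%N); (l, (2 * n).-1)]
       | None => ps
       end.

Definition PsiPhi (n : nat) (x : seq int * seq nat) : {ffun 'I_(2 * n - 2) -> 'I_(2 * n - 2)} :=
  matching_of (2 * n - 2) (Psi_pairs (Phi x.1 x.2)).

Definition Psi'Phi' (n : nat) (x : seq int * seq nat) : {ffun 'I_(2 * n) -> 'I_(2 * n)} :=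
  matching_of (2 * n) (Psi'_pairs (Phi' x.1 x.2)).

Definition bij_between (X Y : Type) (A : X -> Prop) (B : Y -> Prop) (f : X -> Y) : Prop :=
  [/\ forall x, A x -> B (f x),
      forall x y, A x -> A y -> f x = f y -> x = y &
      forall y, B y -> exists2 x, A x & f x = y].

(* Main.v *)
Require Import Defs.
From mathcomp Require Import all_boot all_algebra.
From mathcomp Require Import zify.
Set Implicit Arguments. Unset Strict Implicit. Unset Printing Implicit Defensive.

(** Trees are compared up to the order of siblings ([teq]).

    Labelling a tree amounts to contracting repeatedly the cherry with the
    least leaf label into a leaf carrying the next label. Conversely, a matching
    of [k] leaf labels and [k - 2] later labels has, by pigeonhole, a pair of
    leaf labels; grafting the least such pair onto the tree obtained by induction
    for the remaining labels inverts the contraction step. Doing this with an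
    arbitrary marking of the labels settles the marked trees at the same time:
    the partner of [2n] is the marked label, and joining the partners of
    [2n - 1] and [2n] gives back the matching of the unmarked tree.

    A Motzkin path is a down-step, or a level step followed by a Motzkin path,
    or a reversed Motzkin path, a down-step and a Motzkin path; in the last case
    the descent condition on the labels chooses one of the two orders of the
    subtrees, so that the paths are in bijection with the trees up to [teq]. For
    positive paths the step between the two parts may be up or down, and it is
    the label condition that determines it, the order of the subtrees being fixed
    by the mark. *)

(** * Contraction of cherries *)

(** The labelling of [Psi] compares candidates all over the tree, and [Phi] standardises the labels
    at every call, so neither restricts to subtrees with their own labels. Both are therefore
    replaced by relations that permit an induction: [run] for the labelling, [mot] and [pos] for the
    paths. One contraction turns the leaf labels [1..n] into a set that contains [n + 1] and lacks
    two smaller labels; hence runs are studied for arbitrary distinct leaf labels below the next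
    label [c].

    What makes a contraction reversible is that labels from [c] on go to internal vertices only: two
    siblings with labels below [c] form a cherry from the start. The first pair treated can thus be
    read off the matching alone.

    Injectivity, surjectivity and independence of the order of siblings all become statements about
    one predicate, [agrees f mu], with [f] the involution and [mu] the marked labels. The root has
    no sibling, so no pair sees its mark, and [rootmark] is carried along separately. *)

Definition mpair := ((nat * bool) * (nat * bool))%type.

Fixpoint leaves (t : tree) : seq nat :=
  match t with Lf _ l => [:: l] | Nd _ a b => leaves a ++ leaves b end.

Definition rootmark (t : tree) : bool :=
  match t with Lf m _ => m | Nd m _ _ => m end.

Definition cherry (a b : tree) : seq mpair :=
  match a, b with
  | Lf m x, Lf m' y => [:: ((x, m), (y, m'))]
  | _, _ => [::]
  end.

Fixpoint cherries (t : tree) : seq mpair :=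
  match t with
  | Lf _ _ => [::]
  | Nd _ a b => cherry a b ++ cherries a ++ cherries b
  end.

Definition key (pr : mpair) : nat := minn pr.1.1 pr.2.1.

Definition flip (pr : mpair) : mpair := (pr.2, pr.1).

Definition cherry_tree (m : bool) (pr : mpair) : tree :=
  Nd m (Lf pr.1.2 pr.1.1) (Lf pr.2.2 pr.2.1).

Fixpoint graft (c : nat) (pr : mpair) (t : tree) : tree :=
  match t with
  | Lf m l => if l == c then cherry_tree m pr else Lf m l
  | Nd m a b => Nd m (graft c pr a) (graft c pr b)
  end.

(* [run c U ps]: contracting repeatedly the cherry of [U] with the least
   label into a leaf carrying the next label [c], [c + 1], ... until only two
   leaves are left consumes the sibling pairs [ps], in this order. *)
Inductive run : nat -> tree -> seq mpair -> Prop :=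
  | run_base c m pr : run c (cherry_tree m pr) [:: pr]
  | run_step c U pr ps :
      run c.+1 U ps -> c \in leaves U -> uniq (leaves U) ->
      all (fun q => key pr <= key q) (cherries (graft c pr U)) ->
      run c (graft c pr U) (pr :: ps).

Definition fresh (c : nat) (U : tree) : bool :=
  uniq (leaves U) && all (fun x => x < c) (leaves U).

Definition labels_of (ps : seq mpair) : seq nat :=
  flatten [seq [:: pr.1.1; pr.2.1] | pr <- ps].

(** Both orientations of [f] are tested, so exchanging two siblings together with their marks is
    invisible. *)
Definition agrees (f : nat -> nat) (mu : nat -> bool) (pr : mpair) : bool :=
  [&& f pr.1.1 == pr.2.1, f pr.2.1 == pr.1.1,
      mu pr.1.1 == pr.1.2 & mu pr.2.1 == pr.2.2].

Lemma agrees_flip f mu pr : agrees f mu (flip pr) = agrees f mu pr.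
Proof.
by rewrite /agrees /=; do 4 case: (_ == _).
Qed.

Lemma key_flip pr : key (flip pr) = key pr.
Proof. by rewrite /key minnC. Qed.

Lemma leaves_gt0 t : 0 < size (leaves t).
Proof. by elim: t => //= _ a IHa b _; rewrite size_cat addn_gt0 IHa. Qed.

Lemma size_leaves t : size (leaves t) = nleaves t.
Proof. by elim: t => //= _ a <- b <-; rewrite size_cat. Qed.

Lemma rootmark_graft c pr U : rootmark (graft c pr U) = rootmark U.
Proof. by case: U => //= m l; case: eqP. Qed.

Lemma graft_id c pr U : c \notin leaves U -> graft c pr U = U.
Proof.
elim: U => /= [m l|m a IHa b IHb]; first by rewrite inE eq_sym => /negbTE ->.
by rewrite mem_cat negb_or => /andP[ha hb]; rewrite IHa // IHb.
Qed.

(** Putting [c] back on the left, rather than removing it on the right, makes this a linear identity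
    between counts, which [lia] can combine with others. *)
Lemma leaves_graft c pr U : c \in leaves U -> uniq (leaves U) ->
  perm_eq (c :: leaves (graft c pr U)) [:: pr.1.1, pr.2.1 & leaves U].
Proof.
elim: U => /= [m l|m a IHa b IHb].
  rewrite inE => /eqP <- _; rewrite eqxx /=.
  by apply/permP => P /=; lia.
rewrite mem_cat cat_uniq => + /and3P[ua /hasPn hab ub].
case/orP => h.
  have h' : c \notin leaves b by apply/negP => /hab; rewrite /= h.
  rewrite (graft_id _ h'); apply/permP => P.
  by have /permP/(_ P) /= := IHa h ua; rewrite !count_cat; clear; lia.
have h' : c \notin leaves a by exact: hab.
rewrite (graft_id _ h'); apply/permP => P.
by have /permP/(_ P) /= := IHb h ub; rewrite !count_cat; clear; lia.
Qed.

Lemma size_leaves_graft c pr U : c \in leaves U -> uniq (leaves U) ->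
  size (leaves (graft c pr U)) = (size (leaves U)).+1.
Proof. by move=> h u; have /perm_size /= [->] := leaves_graft pr h u. Qed.

(** All labels after grafting are below [c], so [c] has disappeared and may be put back without
    repetition; by [leaves_graft] the labels of [pr] are then distinct from each other and from
    those of [U]. *)
Lemma fresh_graft c pr U : c \in leaves U -> uniq (leaves U) ->
  fresh c (graft c pr U) ->
  [/\ fresh c.+1 U, pr.1.1 < c, pr.2.1 < c, pr.1.1 != pr.2.1 &
      (pr.1.1 \notin leaves U) && (pr.2.1 \notin leaves U)].
Proof.
move=> h u /andP[ug /allP lg]; have pg := leaves_graft pr h u.
have cg : c \notin leaves (graft c pr U).
  by apply/negP => /lg; rewrite ltnn.
have : uniq [:: pr.1.1, pr.2.1 & leaves U].
  by rewrite -(perm_uniq pg) /= cg.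
rewrite /= !inE negb_or => /and3P[/andP[nij iU] jU _].
have lt x : x != c -> x \in [:: pr.1.1, pr.2.1 & leaves U] -> x < c.
  by move=> nx; rewrite -(perm_mem pg) inE (negbTE nx) => /lg.
have lec x : x \in leaves U -> x < c.+1.
  move=> xU; case: (eqVneq x c) => [->//|nx].
  by rewrite ltnS ltnW // lt // !inE xU !orbT.
split=> //; last by rewrite iU.
- by rewrite /fresh u; apply/allP.
- by apply: lt; rewrite ?inE ?eqxx //; apply: contraNneq iU => ->.
- by apply: lt; rewrite ?inE ?eqxx ?orbT //; apply: contraNneq jU => ->.
Qed.

Lemma run_size c U ps : run c U ps -> 2 <= size (leaves U).
Proof.
elim=> // {}c {}U pr {}ps _ IH h u _.
by rewrite size_leaves_graft //; apply: leqW.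
Qed.

(** Each contraction spends one new label, and a tree with [k] leaves undergoes [k - 2] of them, one
    for each internal vertex other than the root. *)
Lemma run_labels c U ps : run c U ps -> fresh c U ->
  perm_eq (labels_of ps) (leaves U ++ iota c (size (leaves U)).-2).
Proof.
elim=> [{}c m pr _|{}c {}U pr {}ps r IH h u _ fg] /=; first by [].
have [fU _ _ _ _] := fresh_graft h u fg.
have := IH fU; have := run_size r; rewrite size_leaves_graft //=.
have pg := leaves_graft pr h u.
case: (size _) => [|[|n]] //= _ pIH; apply/permP => P /=.
have /permP/(_ P) := pIH; have /permP/(_ P) /= := pg.
by rewrite !count_cat /labels_of /=; clear; lia.
Qed.

Lemma cherries_cherry_tree m pr : cherries (cherry_tree m pr) = [:: pr].
Proof. by case: pr => [[? ?] [? ?]]. Qed.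

Lemma cherry_leaves a b q : q \in cherry a b ->
  q.1.1 \in leaves a /\ q.2.1 \in leaves b.
Proof. by case: a b => // m x [] // m' y; rewrite inE => /eqP ->; rewrite !inE. Qed.

Lemma cherries_leaves U q : q \in cherries U ->
  q.1.1 \in leaves U /\ q.2.1 \in leaves U.
Proof.
elim: U => //= m a IHa b IHb; rewrite !mem_cat => /or3P[].
- by move=> /cherry_leaves[-> ->]; rewrite orbT.
- by case/IHa => -> ->.
- by case/IHb => -> ->; rewrite !orbT.
Qed.

(** Grafting makes the leaf [c] internal: this destroys a cherry through [c], creates [pr], and
    leaves all other sibling leaves in place. *)
Lemma cherries_graft c pr U q : c \in leaves U ->
  (q \in cherries (graft c pr U)) =
  (q == pr) || [&& q \in cherries U, q.1.1 != c & q.2.1 != c].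
Proof.
have flt W : c \in leaves W = false -> forall q, q \in cherries W ->
  (q.1.1 != c) && (q.2.1 != c).
  move=> h {}q /cherries_leaves[h1 h2].
  by apply/andP; split; apply/negP => /eqP e; rewrite e ?h in h1 h2.
have chg a b : (q \in cherry (graft c pr a) (graft c pr b)) =
   [&& q \in cherry a b, q.1.1 != c & q.2.1 != c].
  case: a b => [m x|m x1 x2] [m' y|m' y1 y2] //=.
  - case: eqVneq => [->|nx]; case: eqVneq => [->|ny] //=; rewrite ?in_nil;
    rewrite ?inE; case: eqP => //= ->; rewrite /= ?eqxx ?andbF //.
    by rewrite nx ny.
  - by case: eqVneq.
elim: U => /= [m l|m a IHa b IHb].
  by rewrite inE => /eqP <-; rewrite eqxx orbF cherries_cherry_tree inE.
rewrite !mem_cat chg.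
case ca: (c \in leaves a); case cb: (c \in leaves b) => // _.
- by rewrite IHa // IHb //; do ?case: (_ \in _); do ?case: (_ == _).
- rewrite IHa // (graft_id _ (negbT cb)).
  case qb: (q \in cherries b); last by rewrite !orbF; do ?case: (_ \in _) => //=; do ?case: (_ == _).
  by rewrite !orbT (flt b cb q qb) orbT.
- rewrite IHb // (graft_id _ (negbT ca)).
  case qa: (q \in cherries a); last by rewrite /=; do ?case: (_ \in _) => //=; do ?case: (_ == _).
  by rewrite !orbT (flt a ca q qa) orbT.
Qed.

(** Labels from [c] on name contracted vertices, so a consumed pair below [c] consists of two
    original leaves. Cherries are thereby recognised from [ps] without looking at the tree. *)
Lemma run_cherries c U ps q : run c U ps -> fresh c U ->
  (q \in cherries U) = [&& q \in ps, q.1.1 < c & q.2.1 < c].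
Proof.
elim=> [{}c m pr /andP[_]|{}c {}U pr {}ps r IH h u _ fg] /=.
  move=> /and3P[h1 h2 _]; rewrite inE.
  by rewrite -!surjective_pairing; case: eqP => // ->; rewrite h1 h2.
have [fU l1 l2 _ _] := fresh_graft h u fg.
rewrite cherries_graft // IH // inE.
by case: eqP => [->|_] /=; [rewrite l1 l2|case: (q \in ps) => //=; lia].
Qed.

(** * Trees up to the order of siblings *)

Inductive teq : tree -> tree -> Prop :=
  | teq_leaf m l : teq (Lf m l) (Lf m l)
  | teq_node m a b a' b' : teq a a' -> teq b b' -> teq (Nd m a b) (Nd m a' b')
  | teq_swap m a b a' b' : teq a a' -> teq b b' -> teq (Nd m a b) (Nd m b' a').

Lemma teq_refl t : teq t t.
Proof. by elim: t => [m l|m a IHa b IHb]; constructor. Qed.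

Lemma teq_leaves U V : teq U V -> perm_eq (leaves U) (leaves V).
Proof.
elim=> [m l|m a b a' b' _ pa _ pb|m a b a' b' _ pa _ pb] //=.
  by apply: perm_cat.
by rewrite perm_sym perm_catC perm_sym; apply: perm_cat.
Qed.

Lemma teq_graft c pr U V : teq U V -> teq (graft c pr U) (graft c pr V).
Proof.
elim=> [m l|m a b a' b' _ pa _ pb|m a b a' b' _ pa _ pb] /=.
- exact: teq_refl.
- exact: teq_node.
- exact: teq_swap.
Qed.

Lemma teq_graft_flip c pr U V :
  teq U V -> teq (graft c pr U) (graft c (flip pr) V).
Proof.
elim=> [m l|m a b a' b' _ pa _ pb|m a b a' b' _ pa _ pb] /=.
- by case: eqP => _; [apply: teq_swap; apply: teq_refl|apply: teq_refl].
- exact: teq_node.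
- exact: teq_swap.
Qed.

Lemma teq_cherries U V q : teq U V -> q \in cherries U ->
  (q \in cherries V) || (flip q \in cherries V).
Proof.
elim=> // m a b a' b' ta IHa tb IHb /=; rewrite !mem_cat => /or3P[h|h|h].
- case: ta h tb {IHa IHb} => // m1 x h tb; case: tb h => // m2 y /=.
  by rewrite inE => ->.
- by case/orP: (IHa h) => ->; rewrite ?orbT.
- by case/orP: (IHb h) => ->; rewrite ?orbT.
- case: ta h tb {IHa IHb} => // m1 x h tb; case: tb h => // m2 y /=.
  by rewrite !inE => /eqP ->; rewrite /flip /= eqxx ?orbT.
- by case/orP: (IHa h) => ->; rewrite ?orbT.
- by case/orP: (IHb h) => ->; rewrite ?orbT.
Qed.

(** [c] labels a single leaf, so the equivalence can be followed down to it; [b] records whether it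
    exchanges the two leaves grafted there. *)
Lemma teq_graft_inv c pr U V :
  c \in leaves U -> uniq (leaves U) -> teq (graft c pr U) V ->
  exists V' b, teq U V' /\ V = graft c (if b then flip pr else pr) V'.
Proof.
elim: U V => [m l|m a IHa b IHb] V /=.
  rewrite inE => /eqP <- _; rewrite eqxx => T.
  inversion T as [|? ? ? a' b' ta tb|? ? ? a' b' ta tb]; inversion ta; inversion tb; subst.
    by exists (Lf m c), false; split; [constructor|rewrite /= eqxx].
  by exists (Lf m c), true; split; [constructor|rewrite /= eqxx].
rewrite mem_cat cat_uniq => + /and3P[ua /hasPn hab ub].
case/orP => h T.
  have h' : c \notin leaves b by apply/negP => /hab; rewrite /= h.
  rewrite (graft_id _ h') in T.
  inversion T as [|? ? ? a' b' ta tb|? ? ? a' b' ta tb]; subst;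
  have [V' [o [tV' ->]]] := IHa _ h ua ta; rewrite (perm_mem (teq_leaves tb)) in h'.
    by exists (Nd m V' b'), o; split; [constructor|rewrite /= (graft_id _ h')].
  by exists (Nd m b' V'), o; split; [apply: teq_swap|rewrite /= (graft_id _ h')].
have h' : c \notin leaves a by exact: hab.
rewrite (graft_id _ h') in T.
inversion T as [|? ? ? a' b' ta tb|? ? ? a' b' ta tb]; subst;
have [V' [o [tV' ->]]] := IHb _ h ub tb; rewrite (perm_mem (teq_leaves ta)) in h'.
  by exists (Nd m a' V'), o; split; [constructor|rewrite /= (graft_id _ h')].
by exists (Nd m V' a'), o; split; [apply: teq_swap|rewrite /= (graft_id _ h')].
Qed.

(** The same contractions are made on the reordered tree; only the orientation of the pairs changes,
    which [key] and [agrees] ignore. *)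
Lemma run_teq c U ps V : run c U ps -> fresh c U -> teq U V ->
  exists2 ps', run c V ps' &
    forall f mu, all (agrees f mu) ps -> all (agrees f mu) ps'.
Proof.
move=> r; elim: r V => [{}c m pr|{}c {}U pr {}ps r IH h u mk] V fU T.
  inversion T as [|? ? ? a' b' ta tb|? ? ? a' b' ta tb]; inversion ta; inversion tb; subst.
    by exists [:: pr] => //; constructor.
  exists [:: flip pr]; first exact: (run_base c m (flip pr)).
  by move=> f mu; rewrite /= agrees_flip.
have [V' [o [tV' eV]]] := teq_graft_inv h u T.
have [fU' _ _ _ _] := fresh_graft h u fU.
have [ps' r' ag] := IH V' fU' tV'.
have pl := teq_leaves tV'.
exists ((if o then flip pr else pr) :: ps').
  rewrite eV; constructor=> //.
  - by rewrite -(perm_mem pl).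
  - by rewrite -(perm_uniq pl).
  - rewrite -eV; apply/allP => q qV.
    (* Symmetry of [teq]: a cherry of [V] is traced back to the grafted tree, where the key of [pr]
       is least. *)
    have T' : teq V (graft c pr U).
      move: T; elim=> [? ?|? ? ? ? ? _ ? _ ?|? ? ? ? ? _ ? _ ?];
        [exact: teq_leaf|exact: teq_node|exact: teq_swap].
    have kk : key (if o then flip pr else pr) = key pr by case: o {eV}; rewrite ?key_flip.
    rewrite kk; move/allP: mk => mk; have /orP[/mk//|/mk] := teq_cherries T' qV.
    by rewrite key_flip.
move=> f mu /= /andP[a1 a2]; apply/andP; split; last exact: ag.
by case: o {eV}; rewrite ?agrees_flip.
Qed.

(** Contraction is obtained as a preimage under [graft]. As [c] is a new label, the subtrees away
    from the cherry are fixed by [graft]. *)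
Lemma cherry_ungraft c q U : q \in cherries U -> c \notin leaves U ->
  uniq (leaves U) ->
  exists U', [/\ U = graft c q U', c \in leaves U' & uniq (leaves U')].
Proof.
elim: U => //= m a IHa b IHb.
rewrite !mem_cat negb_or cat_uniq => hq /andP[ca cb] /and3P[ua /hasPn hab ub].
case/or3P: hq => hq.
- case: a b hq {IHa IHb ca cb ua hab ub} => // m1 x [] // m2 y.
  by rewrite inE => /eqP ->; exists (Lf m c); rewrite /= eqxx inE eqxx.
- have [a' [ea ca' ua']] := IHa hq ca ua.
  exists (Nd m a' b); rewrite /= -ea (graft_id _ cb) mem_cat ca'; split=> //.
  rewrite cat_uniq ua' ub andbT; apply/hasPn => x xb; apply/negP => /= xa'.
  have /perm_mem/(_ x) := leaves_graft q ca' ua'; rewrite !inE xa' !orbT -ea.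
  by case/orP => [/eqP ex|xa]; [rewrite ex (negbTE cb) in xb|have := hab x xb; rewrite /= xa].
- have [b' [eb cb' ub']] := IHb hq cb ub.
  exists (Nd m a b'); rewrite /= -eb (graft_id _ ca) mem_cat cb' orbT; split=> //.
  rewrite cat_uniq ub' ua andbT; apply/hasPn => x xb'; apply/negP => /= xa.
  have /perm_mem/(_ x) := leaves_graft q cb' ub'; rewrite !inE xb' !orbT -eb.
  by case/orP => [/eqP ex|xb]; [rewrite ex (negbTE ca) in xa|have := hab x xb; rewrite /= xa].
Qed.

Lemma cherries_nonempty U : 2 <= size (leaves U) -> cherries U != [::].
Proof.
elim: U => //= m a IHa b IHb _.
case: a IHa => [m1 x|m1 a1 a2] IHa.
  case: b IHb => [m2 y|m2 b1 b2] IHb //.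
  by apply: IHb; rewrite /= size_cat; have := leaves_gt0 b1; have := leaves_gt0 b2; lia.
have : cherries (Nd m1 a1 a2) != [::].
  by apply: IHa; rewrite /= size_cat; have := leaves_gt0 a1; have := leaves_gt0 a2; lia.
by rewrite -!size_eq0 !size_cat /=; lia.
Qed.

Lemma seq_argmin (T : eqType) (w : T -> nat) (s : seq T) : s != [::] ->
  exists2 q, q \in s & all (fun x => w q <= w x) s.
Proof.
elim: s => // x [|y s] IH _; first by exists x; rewrite ?inE //= leqnn.
have [//|q qs /allP aq] := IH; case: (leqP (w x) (w q)) => h.
  exists x; first by rewrite inE eqxx.
  by apply/allP => z; rewrite inE => /predU1P[->//|/aq]; apply: leq_trans.
exists q; first by rewrite in_cons qs orbT.
by apply/allP => z; rewrite in_cons => /predU1P[->|/aq //]; exact: ltnW.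
Qed.

Lemma run_total c U : fresh c U -> 2 <= size (leaves U) ->
  exists ps, run c U ps.
Proof.
move: {2}(size _) (erefl (size (leaves U))) => n.
elim: n c U => [|n IH] c U sU fU; first by rewrite sU.
case: n IH sU => [|[|n]] IH sU; rewrite sU // => _.
  case: U sU fU => //= m a b; rewrite size_cat.
  case: a => [m1 x|m1 a1 a2] /=; last first.
    by rewrite size_cat; have := leaves_gt0 a1; have := leaves_gt0 a2; have := leaves_gt0 b; lia.
  case: b => [m2 y|m2 b1 b2] /=; last first.
    by rewrite size_cat; have := leaves_gt0 b1; have := leaves_gt0 b2; lia.
  by move=> _ _; exists [:: ((x, m1), (y, m2))]; exact: (run_base c m ((x, m1), (y, m2))).
have [q qU mq] : exists2 q, q \in cherries U & all (fun x => key q <= key x) (cherries U).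
  by apply: seq_argmin; apply: cherries_nonempty; rewrite sU.
have cU : c \notin leaves U.
  by apply/negP; case/andP: fU => _ /allP h /h; rewrite ltnn.
have uU : uniq (leaves U) by case/andP: fU.
have [U' [eU cU' uU']] := cherry_ungraft qU cU uU.
rewrite eU in fU mq sU *; have [fU' _ _ _ _] := fresh_graft cU' uU' fU.
move: sU; rewrite size_leaves_graft // => -[sU'].
by have [|ps r] := IH c.+1 U' sU' fU'; [rewrite sU'|exists (q :: ps); constructor].
Qed.

(** * A tree is determined by its involution, and every involution occurs *)

Lemma run_inv_base c V qs : run c V qs -> size (leaves V) = 2 ->
  exists m pr, V = cherry_tree m pr /\ qs = [:: pr].
Proof.
case=> [{}c m pr _|{}c {}V pr {}qs r h u _]; first by exists m, pr.
by rewrite size_leaves_graft //; have := run_size r; lia.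
Qed.

Lemma run_inv_step c V qs : run c V qs -> 2 < size (leaves V) ->
  exists W pr ws, [/\ V = graft c pr W, qs = pr :: ws, run c.+1 W ws,
    (c \in leaves W) && uniq (leaves W) &
    all (fun q => key pr <= key q) (cherries V)].
Proof.
case=> [{}c m pr|{}c {}V pr {}qs r h u mk _]; first by rewrite /= ltnn.
by exists V, pr, qs; rewrite h u.
Qed.

(** The first contraction is forced by [f]: a pair of leaf labels matched by [f] is a cherry of both
    trees, so each first pair has a key at most that of the other. Equal keys make the pairs equal
    up to [flip], and the induction continues after contracting both. *)
Lemma run_inj f mu c U ps V qs :
  run c U ps -> run c V qs -> fresh c U -> perm_eq (leaves U) (leaves V) ->
  all (agrees f mu) ps -> all (agrees f mu) qs ->
  rootmark U = rootmark V -> teq U V.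
Proof.
move=> r; elim: r V qs => [{}c m pr|{}c {}U pr {}ps r IH h u mk] V qs r' fU pUV aU aV rm.
  have sV : size (leaves V) = 2 by rewrite -(perm_size pUV).
  have [m' [pr' [eV eqs]]] := run_inv_base r' sV; subst V qs.
  move: aU aV pUV rm fU; rewrite /= !andbT => aU aV /perm_mem pUV <-.
  case: pr pr' aU aV pUV {r' sV} => [[i mi] [j mj]] [[i' mi'] [j' mj']].
  rewrite /fresh /agrees /= inE !andbT => /and4P[/eqP fi /eqP fj /eqP mui /eqP muj].
  case/and4P => /eqP fi' /eqP fj' /eqP mui' /eqP muj' pUV /andP[nij _].
  have := pUV i; rewrite !inE eqxx => /esym/orP[]/eqP e.
    suff -> : ((i', mi'), (j', mj')) = ((i, mi), (j, mj)) by apply: teq_refl.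
    by congr ((_, _), (_, _)); congruence.
  suff -> : ((i', mi'), (j', mj')) = ((j, mj), (i, mi)).
    by apply: teq_swap; apply: teq_leaf.
  by congr ((_, _), (_, _)); congruence.
have [fU' l1 l2 n12 _] := fresh_graft h u fU.
have fV : fresh c V.
  by move: fU; rewrite /fresh (perm_uniq pUV) (perm_all _ pUV).
have sV : 2 < size (leaves V).
  by rewrite -(perm_size pUV) size_leaves_graft //; exact: run_size r.
have [W [pr' [ws [eV eqs r2 /andP[h' u'] mk']]]] := run_inv_step r' sV.
subst V qs; move: W ws r2 h' u' mk' r' fV aV pUV rm sV => V qs r' h' u' mk' rV fV aV pUV rm _.
have [fV' l1' l2' n12' _] := fresh_graft h' u' fV.
have rU : run c (graft c pr U) (pr :: ps) by constructor.
(* A pair of [f] made of two leaves is a cherry in every tree that realises [f]. *)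
have cross W ws q : run c W ws -> fresh c W -> all (agrees f mu) ws ->
    agrees f mu q -> q.1.1 \in leaves W -> q.1.1 < c -> q.2.1 < c ->
    q \in cherries W \/ flip q \in cherries W.
  move=> rW fW /allP aW aq qW lq1 lq2.
  have : q.1.1 \in labels_of ws.
    by rewrite (perm_mem (run_labels rW fW)) mem_cat qW.
  case/flattenP => _ /mapP[w wW ->]; rewrite !inE => hw.
  rewrite !(run_cherries _ rW fW) /= lq1 lq2 !andbT.
  case/and4P: (aW w wW) => /eqP a1 /eqP a2 /eqP a3 /eqP a4.
  case/and4P: aq => /eqP b1 /eqP b2 /eqP b3 /eqP b4.
  case: w wW hw a1 a2 a3 a4 => [[x mx] [y my]] wW /= hw a1 a2 a3 a4.
  case: q b1 b2 b3 b4 hw {qW lq1 lq2} => [[x' mx'] [y' my']] /= b1 b2 b3 b4 /orP[]/eqP e.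
    left; suff -> : ((x', mx'), (y', my')) = ((x, mx), (y, my)) by [].
    have ey : y' = y by rewrite -b1 e.
    by congr ((_, _), (_, _)); congruence.
  right; suff -> : flip ((x', mx'), (y', my')) = ((x, mx), (y, my)) by [].
  have ey : y' = x by rewrite -b1 e.
  by congr ((_, _), (_, _)); congruence.
have mU q : q \in leaves (graft c pr U) = (q \in leaves (graft c pr' V)).
  exact: perm_mem.
have in1 : pr.1.1 \in leaves (graft c pr U).
  have /perm_mem/(_ pr.1.1) := leaves_graft pr h u.
  by rewrite !inE eqxx /= => /orP[/eqP e|//]; rewrite e ltnn in l1.
have in1' : pr'.1.1 \in leaves (graft c pr' V).
  have /perm_mem/(_ pr'.1.1) := leaves_graft pr' h' u'.
  by rewrite !inE eqxx /= => /orP[/eqP e|//]; rewrite e ltnn in l1'.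
have ap : agrees f mu pr by case/andP: aU.
have ap' : agrees f mu pr' by case/andP: aV.
have k1 : key pr' <= key pr.
  have [] := cross _ _ pr rV fV aV ap; rewrite -?mU // => /(allP mk') //.
  by rewrite key_flip.
have k2 : key pr <= key pr'.
  have [] := cross _ _ pr' rU fU aU ap'; rewrite ?mU // => /(allP mk) //.
  by rewrite key_flip.
have epr : pr' = pr \/ pr' = flip pr.
  have : key pr = key pr' by apply/eqP; rewrite eqn_leq k1 k2.
  case/and4P: ap => /eqP a1 /eqP a2 /eqP a3 /eqP a4.
  case/and4P: ap' => /eqP b1 /eqP b2 /eqP b3 /eqP b4.
  move: a1 a2 a3 a4 b1 b2 b3 b4; rewrite /key /flip.
  case: pr {mk fU pUV aU rm l1 l2 n12 rU mU in1 k1 k2} => [[x mx] [y my]].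
  case: pr' {mk' aV fV l1' l2' n12' rV in1'} => [[x' mx'] [y' my']] /= a1 a2 a3 a4 b1 b2 b3 b4 e.
  (* Equal minima give the two pairs a common label, and [f] determines the partner of that
     label. *)
  have [ex|ex] : x = x' \/ x = y'.
    have : x = x' \/ x = y' \/ y = x' \/ y = y'.
      by move: e; rewrite /minn; clear; do 2 case: ltnP => _; tauto.
    case=> [->|[->|[ey|ey]]]; [by left|by right|right|left].
      by rewrite -a2 ey b1.
    by rewrite -a2 ey b2.
  - by left; congr ((_, _), (_, _)); congruence.
  - by right; congr ((_, _), (_, _)); congruence.
have pl : perm_eq (leaves U) (leaves V).
  have /permP p1 := leaves_graft pr h u; have /permP p2 := leaves_graft pr' h' u'.
  have /permP p3 := pUV; apply/permP => P.
  have := p1 P; have := p2 P; have := p3 P => /=.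
  by case: epr => -> /=; clear; lia.
have rm' : rootmark U = rootmark V by move: rm; rewrite !rootmark_graft.
have T : teq U V.
  by apply: IH r' fU' pl _ _ rm'; [case/andP: aU|case/andP: aV].
by case: epr => ->; [apply: teq_graft|apply: teq_graft_flip].
Qed.

Lemma run_surj f mu c A m r :
  uniq A -> all (fun x => x < c) A -> size A = m.+2 ->
  (forall x, x \in A ++ iota c m ->
     [/\ f x \in A ++ iota c m, f (f x) = x & f x != x]) ->
  exists U ps, [/\ run c U ps, perm_eq (leaves U) A, all (agrees f mu) ps &
                  rootmark U = r].
Proof.
elim: m c A => [|m IH] c A uA lA sA fA.
  case: A uA lA sA fA => [|a [|b []]] //= uA _ _ fA.
  exists (cherry_tree r ((a, mu a), (b, mu b))), [:: ((a, mu a), (b, mu b))].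
  split=> //; first exact: (run_base c r ((a, mu a), (b, mu b))).
  have [h1 h2 h3] := fA a (mem_head _ _); move: h1.
  rewrite !inE (negbTE h3) /= => /eqP h1.
  by rewrite h1 in h2; rewrite /agrees /= h1 h2 !eqxx.
have fA1 x : x \in A -> [/\ f x \in A ++ iota c m.+1, f (f x) = x & f x != x].
  by move=> xA; apply: fA; rewrite mem_cat xA.
(* [f] cannot send the [m.+3] elements of [A] into the [m.+1] later labels. *)
have [i0 i0A fi0A] : exists2 i, i \in A & f i \in A.
  apply/hasP; apply: contraT => /hasPn hn.
  have inj : uniq (map f A).
    rewrite map_inj_in_uniq // => x y xA yA e.
    by have [_ <- _] := fA1 x xA; have [_ <- _] := fA1 y yA; rewrite e.
  have : size (map f A) <= size (iota c m.+1).
    apply: uniq_leq_size => // _ /mapP[x xA ->].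
    by have [h _ _] := fA1 x xA; move: h; rewrite mem_cat (negbTE (hn x xA)).
  by rewrite size_map size_iota sA ltnNge leqnSn.
have [i /andP[iA fiA] /allP mi] : exists2 i, (i \in A) && (f i \in A) &
    all (fun x => i <= x) [seq x <- A | f x \in A].
  have [|q] := @seq_argmin _ id [seq x <- A | f x \in A].
    by rewrite -has_filter; apply/hasP; exists i0.
  by rewrite mem_filter andbC => qA aq; exists q.
have [_ ffi nfi] := fA1 i iA.
set j := f i in fiA ffi nfi.
have pA : perm_eq A [:: i, j & rem j (rem i A)].
  rewrite (permPl (perm_to_rem iA)) perm_cons; apply: perm_to_rem.
  by rewrite mem_rem_uniq // inE nfi.
set B := rem j (rem i A) in pA.
have uB : uniq [:: i, j & B] by rewrite -(perm_uniq pA).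
have lB : all (fun x => x < c) [:: i, j & B] by rewrite -(perm_all _ pA).
have cB : c \notin B.
  by apply/negP => cB; move/allP: lB => /(_ c); rewrite !inE cB !orbT ltnn => /(_ isT).
case/and3P: (uB) => iB jB uB'; move: iB; rewrite inE negb_or => /andP[nij iB].
case/and3P: (lB) => li lj lB'.
have memD x : (x \in A ++ iota c m.+1) =
    [|| x == i, x == j | x \in (c :: B) ++ iota c.+1 m].
  by rewrite !mem_cat (perm_mem pA) !inE -!orbA; do ?bool_congr; case: (x \in B); rewrite ?orbT.
(* The contracted vertex [c] joins the leaf labels in place of [i] and [j]; [f] preserves the
   remaining labels because [i] and [j] are partners of each other. *)
have [||||U' [ps [r' pU' ag rm]]] := IH c.+1 (c :: B).
- by rewrite /= cB.
- by rewrite /= ltnSn; apply/allP => x xB; apply: ltnW; move/allP: lB'; apply.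
- by have := perm_size pA; rewrite sA /= => -[->].
- move=> x xD; have [|h1 h2 h3] := fA x; first by rewrite memD xD !orbT.
  split=> //; move: h1; rewrite memD => /or3P[/eqP e|/eqP e|//]; exfalso.
    have ex : x = j by rewrite -h2 e.
    move: xD; rewrite ex mem_cat mem_iota !inE (negbTE jB); lia.
  have ex : x = i by rewrite -h2 e ffi.
  move: xD; rewrite ex mem_cat mem_iota !inE (negbTE iB); lia.
set pr : mpair := ((i, mu i), (j, mu j)).
have cU' : c \in leaves U' by rewrite (perm_mem pU') inE eqxx.
have uU' : uniq (leaves U') by rewrite (perm_uniq pU') /= cB.
have pU : perm_eq (leaves (graft c pr U')) A.
  have /permP p1 := leaves_graft pr cU' uU'; apply/permP => P.
  have := p1 P; have /permP/(_ P) := pU'; have /permP/(_ P) /= := pA; clear; lia.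
have agp : agrees f mu pr by rewrite /agrees /= !eqxx ffi eqxx.
exists (graft c pr U'), (pr :: ps); split=> //; last by rewrite rootmark_graft.
  (* Every cherry of the grafted tree agrees with [f] and has both labels in [A]; by the choice of
     [i] its key is at least [i], which is the key of [pr]. *)
  apply: run_step => //; apply/allP => q qU.
  have [q1 q2] := cherries_leaves qU; rewrite !(perm_mem pU) in q1 q2.
  have fU' : fresh c.+1 U'.
    rewrite /fresh uU' (perm_all _ pU') /= ltnSn; apply/allP => x xB.
    by apply: ltnW; move/allP: lB'; apply.
  have aq : agrees f mu q.
    move: qU; rewrite cherries_graft // (run_cherries q r' fU').
    by case/predU1P => [->//|/andP[/andP[/(allP ag)]]].
  have le_i x y : x \in A -> y \in A -> f x = y -> i <= x.
    by move=> xA yA e; apply: mi; rewrite mem_filter e yA.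
  case/and4P: aq => /eqP a1 /eqP a2 _ _.
  have := le_i _ _ q1 q2 a1; have := le_i _ _ q2 q1 a2.
  have : i <= j by apply: le_i fiA iA ffi.
  by rewrite /key /=; clear; lia.
by rewrite /= agp.
Qed.

(** * The labelling algorithm and matchings *)

Fixpoint marked_pairs (t : ltree) : seq mpair :=
  match t with
  | LLf _ _ => [::]
  | LNd _ _ a b =>
      ((lab a, markof a), (lab b, markof b)) :: (marked_pairs a ++ marked_pairs b)
  end.

Definition unmark (pr : mpair) : nat * nat := (pr.1.1, pr.2.1).

Lemma sib_pairs_unmark t : sib_pairs t = map unmark (marked_pairs t).
Proof. by elim: t => //= m o a -> b ->; rewrite map_cat. Qed.

Fixpoint labelled (t : ltree) : bool :=
  match t with
  | LLf _ _ => true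
  | LNd _ o a b => [&& isSome o, labelled a & labelled b]
  end.

Lemma rk_labelled t : labelled t -> rk t = [::].
Proof. by elim: t => //= m [o|] a IHa b IHb //= /andP[/IHa-> /IHb->]. Qed.

Lemma assign_labelled k c t : labelled t -> assign k c t = t.
Proof. by elim: t => //= m [o|] a IHa b IHb //= /andP[/IHa-> /IHb->]. Qed.

(* The states of the labelling algorithm are the trees [expand e U]: [U] is
   what remains once every labelled subtree is contracted to a leaf, and [e]
   remembers the contracted subtrees. *)
Fixpoint expand (e : bool -> nat -> ltree) (t : tree) : ltree :=
  match t with
  | Lf m l => e m l
  | Nd m a b => LNd m None (expand e a) (expand e b)
  end.

Fixpoint contracted_pairs (e : bool -> nat -> ltree) (t : tree) : seq mpair :=
  match t with
  | Lf m l => marked_pairs (e m l)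
  | Nd m a b => contracted_pairs e a ++ contracted_pairs e b
  end.

Definition faithful (e : bool -> nat -> ltree) : Prop :=
  forall m l, [/\ labof (e m l) = Some l, markof (e m l) = m & labelled (e m l)].

(** One round of labelling leaves the tree alone and only changes what a leaf stands for: the leaf
    [c] now stands for a vertex labelled [c] over the two subtrees that [pr] stood for. *)
Definition contract (e : bool -> nat -> ltree) (c : nat) (pr : mpair)
    (m : bool) (l : nat) : ltree :=
  if l == c then LNd m (Some c) (e pr.1.2 pr.1.1) (e pr.2.2 pr.2.1) else e m l.

Lemma faithful_contract e c pr : faithful e -> faithful (contract e c pr).
Proof.
move=> fe m l; rewrite /contract; case: eqP => [->|_]; last exact: fe.
by have [_ _ h1] := fe pr.1.2 pr.1.1; have [_ _ h2] := fe pr.2.2 pr.2.1; rewrite /= h1 h2.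
Qed.

Lemma labof_expand e t : faithful e ->
  labof (expand e t) = if t is Lf _ l then Some l else None.
Proof. by move=> fe; case: t => //= m l; have [] := fe m l. Qed.

Lemma keyof_expand e m a b : faithful e ->
  keyof (LNd m None (expand e a) (expand e b)) =
  if cherry a b is pr :: _ then Some (key pr) else None.
Proof. by move=> fe; rewrite /= !labof_expand //; case: a b => [? ?|? ? ?] []. Qed.

(** Contracted subtrees are fully labelled and offer no candidate, so the vertices that the
    algorithm may treat are the cherries of what remains. *)
Lemma rk_expand e t : faithful e -> rk (expand e t) = map key (cherries t).
Proof.
move=> fe; elim: t => [m l|m a IHa b IHb].
  by have [_ _ h] := fe m l; rewrite /= rk_labelled.
rewrite [LHS]/= -/(keyof (LNd m None _ _)) keyof_expand // IHa IHb /= !map_cat.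
by case: a b {IHa IHb} => [? ?|? ? ?] [].
Qed.

(** [assign] finds its vertex by the key alone. This hits only the grafted cherry: any other cherry
    with the same key would contain a label of [pr], and these do not occur in [t]. *)
Lemma assign_expand e c pr t : faithful e ->
  pr.1.1 \notin leaves t -> pr.2.1 \notin leaves t ->
  assign (key pr) c (expand e (graft c pr t)) = expand (contract e c pr) t.
Proof.
move=> fe; elim: t => [m l|m a IHa b IHb].
  move=> _ _; rewrite /= /contract; case: eqP => _; last first.
    by have [_ _ h] := fe m l; rewrite assign_labelled.
  rewrite /cherry_tree /=.
  have [-> _ _] := fe pr.1.2 pr.1.1; have [-> _ _] := fe pr.2.2 pr.2.1.
  by rewrite eqxx.
rewrite [leaves _]/= !mem_cat !negb_or => /andP[i1 i2] /andP[j1 j2].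
rewrite [graft _ _ _]/= [expand _ _]/= [LHS]/= -/(keyof (LNd m None _ _)).
rewrite keyof_expand // IHa // IHb //.
case E : (cherry _ _) => [|q qs] //; case: eqP => // -[ekey]; exfalso.
have : q \in cherry (graft c pr a) (graft c pr b) by rewrite E mem_head.
case: a i1 j1 {E IHa IHb} => [ma x|ma a1 a2] //=; case: eqP => // _.
case: b i2 j2 => [mb y|mb b1 b2] //=; case: eqP => // _.
rewrite !inE => n1 n2 n3 n4 /eqP eq; move: ekey; rewrite eq /key /=; lia.
Qed.

Lemma contracted_pairs_graft e c pr t : c \in leaves t -> uniq (leaves t) ->
  faithful e ->
  perm_eq (contracted_pairs (contract e c pr) t)
          (pr :: contracted_pairs e (graft c pr t)).
Proof.
move=> h u fe.
have nin W : c \notin leaves W ->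
    contracted_pairs (contract e c pr) W = contracted_pairs e W.
  elim: W => [m l|m a IHa b IHb] /=.
    by rewrite inE eq_sym /contract => /negbTE ->.
  by rewrite mem_cat negb_or => /andP[/IHa-> /IHb->].
elim: t h u => [m l|m a IHa b IHb] /=.
  rewrite inE => /eqP <- _; rewrite /contract eqxx /= /lab.
  have [-> -> _] := fe pr.1.2 pr.1.1; have [-> -> _] := fe pr.2.2 pr.2.1.
  by rewrite -!surjective_pairing.
rewrite mem_cat cat_uniq => + /and3P[ua /hasPn hab ub].
case/orP => h.
  have h' : c \notin leaves b by apply/negP => /hab; rewrite /= h.
  rewrite (graft_id _ h') (nin b) //; apply/permP => P.
  by have /permP/(_ P) /= := IHa h ua; rewrite !count_cat; clear; lia.
have h' : c \notin leaves a by exact: hab.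
rewrite (graft_id _ h') (nin a) //; apply/permP => P.
by have /permP/(_ P) /= := IHb h ub; rewrite !count_cat; clear; lia.
Qed.

Lemma foldr_minn_eq k k0 ks : k \in ks -> all (fun x => k <= x) ks -> k <= k0 ->
  foldr minn k0 ks = k.
Proof.
move=> hk /allP ak lk; apply/eqP; rewrite eqn_leq; apply/andP; split.
  elim: ks hk {ak} => //= x s IH; rewrite inE => /predU1P[<-|/IH h]; first exact: geq_minl.
  by rewrite (leq_trans (geq_minr _ _)).
elim: ks ak {hk} => //= x s IH ak; rewrite leq_min ak ?mem_head //=.
by apply: IH => y ys; apply: ak; rewrite inE ys orbT.
Qed.

(** One round of the algorithm on [expand e U] is one contraction, performed in the environment
    [contract e c pr]. The fuel bounds the number of rounds, which is two less than the number of
    leaves. *)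
Lemma lab_iter_run e f c U ps : run c U ps -> fresh c U -> faithful e ->
  size (leaves U) <= f.+2 ->
  perm_eq (marked_pairs (lab_iter f c (expand e U))) (ps ++ contracted_pairs e U)
  /\ markof (lab_iter f c (expand e U)) = rootmark U.
Proof.
move=> r; elim: r e f => [{}c m pr|{}c {}U pr {}ps r IH h u mk] e f fU fe sf.
  (* Both children of the root are labelled, so no candidate is left and the state is final. *)
  have -> : lab_iter f c (expand e (cherry_tree m pr)) = expand e (cherry_tree m pr).
    case: f {sf} => //= f.
    have [_ _ h1] := fe pr.1.2 pr.1.1; have [_ _ h2] := fe pr.2.2 pr.2.1.
    by rewrite !rk_labelled.
  split=> //=; rewrite /lab.
  have [-> -> _] := fe pr.1.2 pr.1.1; have [-> -> _] := fe pr.2.2 pr.2.1.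
  by rewrite -!surjective_pairing.
have [fU' l1 l2 n12 /andP[n1 n2]] := fresh_graft h u fU.
rewrite size_leaves_graft // in sf; have s2 := run_size r.
case: f sf => [|f] sf; first by lia.
have -> : lab_iter f.+1 c (expand e (graft c pr U)) =
          lab_iter f c.+1 (expand (contract e c pr) U).
  have prin : pr \in cherries (graft c pr U) by rewrite cherries_graft ?eqxx.
  have := size_leaves_graft pr h u.
  case: U h u mk {r IH fU fU'} prin n1 n2 s2 {sf} => [m l|m a b]; first by rewrite /= ltnn.
  move=> h u mk prin n1 n2 s2 sg.
  (* With at least three leaves the root is not a cherry itself, so all cherries lie in the two
     subtrees that the algorithm inspects. *)
  have ch0 : cherry (graft c pr a) (graft c pr b) = [::].
    move: sg s2; rewrite /=; case: (graft c pr a) => [? ?|? ? ?] //.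
    by case: (graft c pr b) => [? ?|? ? ?] //= -[<-].
  rewrite [graft _ _ _]/= in prin mk *; rewrite [expand _ _]/=.
  rewrite [in LHS]/=.
  rewrite !rk_expand // -map_cat.
  move: prin mk; rewrite /= ch0 /=; set cs := cherries _ ++ cherries _.
  move=> prin mk.
  have kin : key pr \in map key cs by apply: map_f.
  have amk : all (fun x => key pr <= x) (map key cs) by rewrite all_map.
  case E : (map key cs) => [|k0 ks]; first by rewrite E in kin.
  rewrite -E (foldr_minn_eq kin) //; last by move: amk; rewrite E => /andP[].
  move: n1 n2; rewrite /= !mem_cat !negb_or => /andP[i1 i2] /andP[j1 j2].
  by rewrite !assign_expand.
have [IH1 IH2] := IH (contract e c pr) f fU' (faithful_contract c pr fe) sf.
split; last by rewrite IH2 rootmark_graft.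
apply/permP => P; have /permP/(_ P) := IH1.
have /permP/(_ P) := contracted_pairs_graft pr h u fe.
by rewrite /= !count_cat /=; clear; lia.
Qed.

Lemma label_tree_run t ps : run (nleaves t).+1 t ps -> fresh (nleaves t).+1 t ->
  perm_eq (marked_pairs (label_tree t)) ps /\ markof (label_tree t) = rootmark t.
Proof.
move=> r ft.
have ex : expand LLf t = to_l t by elim: t {r ft} => //= m a -> b ->.
have fo : contracted_pairs LLf t = [::] by elim: t {r ft ex} => //= m a -> b ->.
have := @lab_iter_run LLf (nleaves t) _ _ _ r ft.
by rewrite ex fo cats0 size_leaves; apply=> //; rewrite ltnW.
Qed.

(** * Sibling pairs and involutions of the labels *)

Definition pair_labels (ps : seq (nat * nat)) : seq nat :=
  flatten [seq [:: pr.1; pr.2] | pr <- ps].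

Lemma mem_pair_labels ps (q : nat * nat) : q \in ps ->
  q.1 \in pair_labels ps /\ q.2 \in pair_labels ps.
Proof.
by move=> qs; split; apply/flattenP; exists [:: q.1; q.2];
  rewrite ?inE ?eqxx ?orbT // (map_f (fun q : nat * nat => [:: q.1; q.2])).
Qed.

Lemma labels_of_unmark ps : labels_of ps = pair_labels (map unmark ps).
Proof. by rewrite /pair_labels -map_comp. Qed.

Definition matches (g : nat -> nat) (pr : nat * nat) : bool :=
  (g pr.1 == pr.2) && (g pr.2 == pr.1).

Lemma partner_matches g ps x : all (matches g) ps -> x \in pair_labels ps ->
  partner ps x = g x.
Proof.
elim: ps => //= pr ps IH /andP[/andP[/eqP h1 /eqP h2] a].
rewrite !inE; case: (eqVneq pr.1 x) => [<-//|n1]; case: (eqVneq pr.2 x) => [<-//|n2].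
exact: IH.
Qed.

Lemma matches_partner ps : uniq (pair_labels ps) -> all (matches (partner ps)) ps.
Proof.
elim: ps => //= pr ps IH; rewrite inE negb_or.
case/and3P=> /andP[n12 n1] n2 u; rewrite {1}/matches /= eqxx (negbTE n12) !eqxx /=.
apply/allP => q qs; have /andP[/eqP h1 /eqP h2] := allP (IH u) q qs.
have [in1 in2] := mem_pair_labels qs.
have neq x y : x \in pair_labels ps -> y \notin pair_labels ps -> (y == x) = false.
  by move=> hx hy; apply/negbTE; apply: contraNneq hy => ->.
by rewrite /matches /= (neq q.1 pr.1) // (neq q.1 pr.2) //
  (neq q.2 pr.1) // (neq q.2 pr.2) // h1 h2 !eqxx.
Qed.

(** Labels start at 1 and ordinals at 0, whence the shifts; labels above [K] are sent to 0, which is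
    not a label. *)
Definition nat_fun (K : nat) (f : {ffun 'I_K -> 'I_K}) (x : nat) : nat :=
  if insub x.-1 is Some i then (f i).+1 else 0.

Lemma nat_funE K (f : {ffun 'I_K -> 'I_K}) (i : 'I_K) : nat_fun f i.+1 = (f i).+1.
Proof. by rewrite /nat_fun /= valK. Qed.

Lemma mem_labels_ord K ps (i : 'I_K) : perm_eq (pair_labels ps) (iota 1 K) ->
  i.+1 \in pair_labels ps.
Proof. by move=> /perm_mem ->; rewrite mem_iota /= add1n ltnS. Qed.

Lemma matching_of_matches K ps (f : {ffun 'I_K -> 'I_K}) :
  perm_eq (pair_labels ps) (iota 1 K) -> all (matches (nat_fun f)) ps ->
  matching_of K ps = f.
Proof.
move=> pl ag; apply/ffunP => i; rewrite ffunE.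
rewrite (partner_matches ag) ?mem_labels_ord // nat_funE /=.
by apply: val_inj; rewrite val_insubd ltn_ord.
Qed.

Lemma nat_fun_matching_of K ps x :
  perm_eq (pair_labels ps) (iota 1 K) -> x \in pair_labels ps ->
  nat_fun (matching_of K ps) x = partner ps x.
Proof.
move=> pl xl; have u : uniq (pair_labels ps) by rewrite (perm_uniq pl) iota_uniq.
have : x \in iota 1 K by rewrite -(perm_mem pl).
rewrite mem_iota => /andP[x0 xK].
have hx : x.-1 < K by lia.
have -> : x = (Ordinal hx).+1 by rewrite /= prednK.
rewrite nat_funE ffunE val_insubd /= (prednK x0).
have : partner ps x \in pair_labels ps.
  case/flattenP: xl => _ /mapP[q qs ->]; rewrite !inE.
  have /andP[/eqP h1 /eqP h2] := allP (matches_partner u) q qs.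
  have [in1 in2] := mem_pair_labels qs.
  by case/orP => /eqP ->; rewrite ?h1 ?h2.
by rewrite (perm_mem pl) mem_iota => /andP[p0 pK]; case: ltnP; lia.
Qed.

(** With [matching_of_matches], this turns an equality of matchings into a condition on sibling
    pairs, the form in which runs are compared. *)
Lemma matches_matching_of K ps : perm_eq (pair_labels ps) (iota 1 K) ->
  all (matches (nat_fun (matching_of K ps))) ps.
Proof.
move=> pl; have u : uniq (pair_labels ps) by rewrite (perm_uniq pl) iota_uniq.
apply/allP => q qs; have := allP (matches_partner u) q qs.
by have [in1 in2] := mem_pair_labels qs; rewrite /matches !nat_fun_matching_of.
Qed.

Lemma is_matching_of K ps : perm_eq (pair_labels ps) (iota 1 K) ->
  is_matching (matching_of K ps).
Proof.
move=> pl; have ag := matches_matching_of pl.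
have u : uniq (pair_labels ps) by rewrite (perm_uniq pl) iota_uniq.
apply/forallP => i; have := mem_labels_ord i pl.
set f := matching_of K ps in ag *.
case/flattenP => _ /mapP[q qs ->] iq.
have /andP[/eqP h1 /eqP h2] := allP ag q qs.
have n12 : q.1 != q.2.
  elim: ps qs u {pl ag f h1 h2} => //= r ps IH; rewrite inE negb_or.
  by case/predU1P => [->|qs] /and3P[/andP[]] // ? _ _ /IH; apply.
have e : nat_fun f (nat_fun f i.+1) = i.+1 /\ nat_fun f i.+1 != i.+1.
  by move: iq; rewrite !inE => /orP[]/eqP ->; rewrite ?h1 ?h2 ?h1 //; split=> //; rewrite eq_sym.
rewrite !nat_funE eqSS in e; case: e => -[e1] e2.
by apply/andP; split=> //; apply/eqP/val_inj.
Qed.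

Lemma nat_fun_matching K (f : {ffun 'I_K -> 'I_K}) x : is_matching f ->
  x \in iota 1 K ->
  [/\ nat_fun f x \in iota 1 K, nat_fun f (nat_fun f x) = x & nat_fun f x != x].
Proof.
move=> /forallP fm; rewrite mem_iota => /andP[x0 xK].
have hx : x.-1 < K by lia.
have -> : x = (Ordinal hx).+1 by rewrite /= prednK.
case/andP: (fm (Ordinal hx)) => /eqP h1 h2.
by rewrite !nat_funE h1 eqSS mem_iota; split=> //; have := ltn_ord (f (Ordinal hx)); lia.
Qed.

(** * From trees to matchings *)

Fixpoint nmarks (t : tree) : nat :=
  match t with Lf m _ => m | Nd m a b => m + nmarks a + nmarks b end.

Definition pair_marks (ps : seq mpair) : nat :=
  sumn (map (fun pr : mpair => (pr.1.2 + pr.2.2)%N) ps).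

Definition valid (n : nat) (t : tree) : bool := perm_eq (leaves t) (iota 1 n).

Lemma teq_nmarks U V : teq U V -> nmarks U = nmarks V.
Proof. by elim=> //= m a b a' b' _ -> _ ->; rewrite addnAC. Qed.

Lemma teq_rootmark U V : teq U V -> rootmark U = rootmark V.
Proof. by case. Qed.

Lemma nmarks_graft c pr U : c \in leaves U -> uniq (leaves U) ->
  nmarks (graft c pr U) = nmarks U + (pr.1.2 + pr.2.2).
Proof.
elim: U => /= [m l|m a IHa b IHb].
  by rewrite inE => /eqP <- _; rewrite eqxx /= addnA.
rewrite mem_cat cat_uniq => + /and3P[ua /hasPn hab ub].
case/orP => h.
  have h' : c \notin leaves b by apply/negP => /hab; rewrite /= h.
  by rewrite (graft_id _ h') IHa // addnA addnAC.
have h' : c \notin leaves a by exact: hab.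
by rewrite (graft_id _ h') IHb // !addnA.
Qed.

(** Every vertex but the root occurs in exactly one sibling pair. *)
Lemma run_marks c U ps : run c U ps -> nmarks U = rootmark U + pair_marks ps.
Proof.
elim=> [{}c m pr|{}c {}U pr {}ps r IH h u _]; first by rewrite /pair_marks /= addn0 addnA.
by rewrite nmarks_graft // IH rootmark_graft /pair_marks /= -addnA (addnC (sumn _)).
Qed.

Lemma valid_run n t : 2 <= n -> valid n t ->
  exists2 ps, run n.+1 t ps &
    [/\ fresh n.+1 t, perm_eq (marked_pairs (label_tree t)) ps,
        markof (label_tree t) = rootmark t &
        perm_eq (labels_of ps) (iota 1 (2 * n - 2))].
Proof.
move=> n2 vt; have sl : size (leaves t) = n by rewrite (perm_size vt) size_iota.
have ft : fresh n.+1 t.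
  rewrite /fresh (perm_uniq vt) iota_uniq (perm_all _ vt).
  by apply/allP => x; rewrite mem_iota add1n => /andP[].
have [|ps r] := run_total ft; first by rewrite sl.
exists ps => //.
have := @label_tree_run t ps; rewrite -size_leaves sl => /(_ r ft)[h1 h2].
split=> //; rewrite (permPl (run_labels r ft)) sl.
have -> : 2 * n - 2 = n + n.-2 by lia.
by rewrite iotaD add1n perm_cat2r.
Qed.

Lemma labels_of_perm ps qs : perm_eq ps qs -> perm_eq (labels_of ps) (labels_of qs).
Proof. by move=> h; apply: perm_flatten; apply: perm_map. Qed.

Lemma label_tree_labels n t : 2 <= n -> valid n t ->
  perm_eq (labels_of (marked_pairs (label_tree t))) (iota 1 (2 * n - 2)).
Proof.
move=> n2 vt; have [ps r [_ pp _ pl]] := valid_run n2 vt.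
by rewrite (permPl (labels_of_perm pp)).
Qed.

Lemma label_tree_rootmark n t : 2 <= n -> valid n t ->
  markof (label_tree t) = rootmark t.
Proof. by move=> n2 vt; have [ps _ []] := valid_run n2 vt. Qed.

Lemma label_tree_marks n t : 2 <= n -> valid n t ->
  nmarks t = rootmark t + pair_marks (marked_pairs (label_tree t)).
Proof.
move=> n2 vt; have [ps r [_ pp _ _]] := valid_run n2 vt.
by rewrite (run_marks r) /pair_marks (perm_sumn (perm_map _ pp)).
Qed.

Lemma label_tree_teq n f mu t u : 2 <= n -> valid n t -> teq t u ->
  all (agrees f mu) (marked_pairs (label_tree t)) ->
  all (agrees f mu) (marked_pairs (label_tree u)).
Proof.
move=> n2 vt tu; have [ps r [ft pp _ _]] := valid_run n2 vt.
have [qs r' ag] := run_teq r ft tu.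
have pl := teq_leaves tu.
have nu : nleaves u = n by rewrite -size_leaves -(perm_size pl) (perm_size vt) size_iota.
have fu : fresh n.+1 u by move: ft; rewrite /fresh (perm_uniq pl) (perm_all _ pl).
have := @label_tree_run u qs; rewrite nu => /(_ r' fu)[pq _].
by rewrite (perm_all _ pp) (perm_all _ pq); apply: ag.
Qed.

Lemma label_tree_inj n f mu t u : 2 <= n -> valid n t -> valid n u ->
  all (agrees f mu) (marked_pairs (label_tree t)) ->
  all (agrees f mu) (marked_pairs (label_tree u)) ->
  rootmark t = rootmark u -> teq t u.
Proof.
move=> n2 vt vu; have [ps r [ft pp _ _]] := valid_run n2 vt.
have [qs r' [_ pq _ _]] := valid_run n2 vu.
rewrite (perm_all _ pp) (perm_all _ pq); apply: run_inj r r' ft _.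
by rewrite (permPl vt) perm_sym.
Qed.

Lemma label_tree_surj n f mu r : 2 <= n ->
  (forall x, x \in iota 1 (2 * n - 2) ->
     [/\ f x \in iota 1 (2 * n - 2), f (f x) = x & f x != x]) ->
  exists t, [/\ valid n t, all (agrees f mu) (marked_pairs (label_tree t)) &
               rootmark t = r].
Proof.
move=> n2; have -> : 2 * n - 2 = n + n.-2 by lia.
rewrite iotaD add1n => hf.
have [||||U [ps [rU vU ag rm]]] := @run_surj f mu n.+1 (iota 1 n) n.-2 r.
- exact: iota_uniq.
- by apply/allP => x; rewrite mem_iota add1n => /andP[].
- by rewrite size_iota; lia.
- exact: hf.
exists U; split=> //.
have nU : nleaves U = n by rewrite -size_leaves (perm_size vU) size_iota.
have fU : fresh n.+1 U.
  rewrite /fresh (perm_uniq vU) iota_uniq (perm_all _ vU).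
  by apply/allP => x; rewrite mem_iota add1n => /andP[].
have := @label_tree_run U ps; rewrite nU => /(_ rU fU)[pp _].
by rewrite (perm_all _ pp).
Qed.

Lemma pair_marks0 ps pr : pair_marks ps = 0 -> pr \in ps ->
  pr.1.2 = false /\ pr.2.2 = false.
Proof.
rewrite /pair_marks; elim: ps => //= q ps IH /eqP; rewrite !addn_eq0.
case/andP => /andP[/eqP h1 /eqP h2] /eqP h3; rewrite inE => /predU1P[->|/IH]; last exact.
by case: (q.1.2) (q.2.2) h1 h2 => [] [].
Qed.

Lemma pair_marks_agrees f mu ps : all (agrees f mu) ps ->
  pair_marks ps = count mu (labels_of ps).
Proof.
rewrite /pair_marks /labels_of; elim: ps => //= pr ps IH.
by case/andP=> /and4P[_ _ /eqP -> /eqP ->] /IH ->; rewrite addnA.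
Qed.

Lemma sib_pairs_labels n t : 2 <= n -> valid n t ->
  perm_eq (pair_labels (sib_pairs (label_tree t))) (iota 1 (2 * n - 2)).
Proof.
by move=> n2 vt; rewrite sib_pairs_unmark -labels_of_unmark label_tree_labels.
Qed.

Lemma agrees_matches f mu ps : all (agrees f mu) ps -> all (matches f) (map unmark ps).
Proof.
by move=> ag; rewrite all_map; apply: sub_all ag => pr /and4P[h1 h2 _ _]; apply/andP.
Qed.

(** Without marks, [matches] already yields [agrees] with the empty set of marked labels; this
    brings unmarked trees under the lemmas on runs. *)
Lemma unmarked_agrees n t f : 2 <= n -> valid n t -> nmarks t = 0 ->
  all (matches f) (sib_pairs (label_tree t)) ->
  all (agrees f xpred0) (marked_pairs (label_tree t)).
Proof.
move=> n2 vt m0; rewrite sib_pairs_unmark all_map => /allP h.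
apply/allP => pr hpr; have /andP[h1 h2] := h pr hpr.
have pm : pair_marks (marked_pairs (label_tree t)) = 0.
  by apply/eqP; move/eqP: m0; rewrite (label_tree_marks n2 vt) addn_eq0 => /andP[].
by have [e1 e2] := pair_marks0 pm hpr; rewrite /agrees e1 e2 h1 h2.
Qed.

Lemma Psi_matching n t : 2 <= n -> valid n t ->
  is_matching (matching_of (2 * n - 2) (Psi_pairs t)).
Proof. by move=> n2 vt; apply: is_matching_of; apply: sib_pairs_labels. Qed.

Lemma Psi_inj n t u : 2 <= n -> valid n t -> valid n u ->
  nmarks t = 0 -> nmarks u = 0 ->
  matching_of (2 * n - 2) (Psi_pairs t) = matching_of (2 * n - 2) (Psi_pairs u) ->
  teq t u.
Proof.
move=> n2 vt vu mt mu e.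
have at_ := matches_matching_of (sib_pairs_labels n2 vt).
have au := matches_matching_of (sib_pairs_labels n2 vu).
rewrite -/(Psi_pairs u) -e in au.
apply: (label_tree_inj n2 vt vu (unmarked_agrees n2 vt mt at_) (unmarked_agrees n2 vu mu au)).
move: mt mu; rewrite (label_tree_marks n2 vt) (label_tree_marks n2 vu).
by case: (rootmark t); case: (rootmark u).
Qed.

Lemma Psi_surj n f : 2 <= n -> is_matching f ->
  exists t, [/\ valid n t, nmarks t = 0 & matching_of (2 * n - 2) (Psi_pairs t) = f].
Proof.
move=> n2 mf.
have [t [vt ag rm]] := @label_tree_surj n (nat_fun f) xpred0 false n2
  (fun x hx => nat_fun_matching mf hx).
exists t; split=> //.
  rewrite (label_tree_marks n2 vt) rm (pair_marks_agrees ag).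
  by elim: (labels_of _) => //=.
apply: matching_of_matches; first exact: sib_pairs_labels.
by rewrite /Psi_pairs sib_pairs_unmark; apply: agrees_matches ag.
Qed.

Lemma Psi_teq n t u : 2 <= n -> valid n t -> nmarks t = 0 -> teq t u ->
  matching_of (2 * n - 2) (Psi_pairs t) = matching_of (2 * n - 2) (Psi_pairs u).
Proof.
move=> n2 vt mt tu.
have vu : valid n u by rewrite /valid -(permPl (teq_leaves tu)).
apply/esym/matching_of_matches; first exact: sib_pairs_labels.
have ag := unmarked_agrees n2 vt mt (matches_matching_of (sib_pairs_labels n2 vt)).
by have := agrees_matches (label_tree_teq n2 vt tu ag); rewrite -sib_pairs_unmark.
Qed.

(** * Marked trees and the labels [2n - 1], [2n] *)

Definition marked_side (pr : mpair) : option (nat * nat) :=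
  if pr.1.2 then Some (pr.1.1, pr.2.1)
  else if pr.2.2 then Some (pr.2.1, pr.1.1) else None.

Lemma marked_sibE t : marked_sib t = ohead (pmap marked_side (marked_pairs t)).
Proof.
have hcat T (s1 s2 : seq T) : ohead (s1 ++ s2) = if ohead s1 is Some x then Some x else ohead s2.
  by case: s1.
elim: t => //= m o a IHa b IHb; rewrite pmap_cat /marked_side /=.
by case: (markof a) => //=; case: (markof b) => //=; rewrite hcat IHa IHb.
Qed.

(** As the labels are distinct, the single mark is the same datum as its label [k]: all mark bits
    become tests of equality with [k], as [agrees] requires. *)
Lemma one_marked_side ps : pair_marks ps = 1 -> uniq (labels_of ps) ->
  exists k l, [/\ ohead (pmap marked_side ps) = Some (k, l),
    ((k, l) \in map unmark ps) || ((l, k) \in map unmark ps) &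
    forall pr, pr \in ps -> pr.1.2 = (pr.1.1 == k) /\ pr.2.2 = (pr.2.1 == k)].
Proof.
rewrite labels_of_unmark; elim: ps => //= pr ps IH.
rewrite {1}/pair_marks /= -/(pair_marks ps) inE negb_or => pm /and3P[/andP[n12 n1] n2 u].
have neq x (q : mpair) : q \in ps -> x \notin pair_labels (map unmark ps) ->
    (q.1.1 == x) = false /\ (q.2.1 == x) = false.
  move=> qs xn; have [h1 h2] := mem_pair_labels (map_f unmark qs).
  by split; apply/negbTE; apply: contraNneq xn => <-.
rewrite {2}/marked_side; case: pr pm n12 n1 n2 => [[i [|]] [j [|]]] //= pm n12 n1 n2.
- exists i, j; split=> //; first by rewrite inE eqxx.
  have p0 : pair_marks ps = 0 by lia.
  move=> q; rewrite inE => /predU1P[->|qs] /=; first by rewrite eqxx eq_sym (negbTE n12).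
  by have [-> ->] := neq i q qs n1; exact: pair_marks0 p0 qs.
- exists j, i; split=> //; first by rewrite !inE eqxx !orbT.
  have p0 : pair_marks ps = 0 by lia.
  move=> q; rewrite inE => /predU1P[->|qs] /=; first by rewrite eqxx (negbTE n12).
  by have [-> ->] := neq j q qs n2; exact: pair_marks0 p0 qs.
- have [||k [l [h1 h2 h3]]] := IH; [by lia|exact: u|].
  exists k, l; split=> //.
    by rewrite !inE; case/orP: h2 => ->; rewrite !orbT.
  have kl : k \in pair_labels (map unmark ps).
    by case/orP: h2 => /mem_pair_labels [].
  move=> q; rewrite inE => /predU1P[->|qs] /=; last exact: h3.
  by split; apply/esym/negbTE; [apply: contraNneq n1 => -> | apply: contraNneq n2 => ->].
Qed.

(** Distinct labels leave a single pair through [k], so deleting it frees exactly [k] and [l], which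
    [Psi'] then pairs with [2n] and [2n - 1]. *)
Lemma pair_labels_sep ps k l : uniq (pair_labels ps) ->
  ((k, l) \in ps) || ((l, k) \in ps) ->
  [/\ k != l, perm_eq (pair_labels ps)
        [:: k, l & pair_labels [seq pr <- ps | ~~ ((pr.1 == k) || (pr.2 == k))]] &
      forall pr, pr \in ps ->
        [\/ pr = (k, l), pr = (l, k) |
            [/\ pr.1 != k, pr.1 != l, pr.2 != k & pr.2 != l]]].
Proof.
elim: ps => //= pr ps IH; rewrite inE negb_or !inE => /and3P[/andP[n12 n1] n2 u] h.
have neq x (q : nat * nat) : q \in ps -> x \notin pair_labels ps ->
    (q.1 == x) = false /\ (q.2 == x) = false.
  move=> qs xn; have [h1 h2] := mem_pair_labels qs.
  by split; apply/negbTE; apply: contraNneq xn => <-.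
have [e|] := boolP ((pr == (k, l)) || (pr == (l, k))).
  have nk : k \notin pair_labels ps by case/orP: e n1 n2 => /eqP ->.
  have nl : l \notin pair_labels ps by case/orP: e n1 n2 => /eqP ->.
  have ef : [seq p <- ps | ~~ ((p.1 == k) || (p.2 == k))] = ps.
    by apply/all_filterP/allP => q qs; have [-> ->] := neq k q qs nk.
  have kl : k != l by case/orP: e n12 => /eqP -> //=; rewrite eq_sym.
  split=> //.
    rewrite ef; have -> : (pr.1 == k) || (pr.2 == k) by case/orP: e => /eqP ->; rewrite /= eqxx ?orbT.
    by case/orP: e => /eqP -> //=; apply/permP => P /=; rewrite addnCA.
  move=> q; rewrite inE => /predU1P[->|qs].
    by case/orP: e => /eqP ->; [apply: Or31|apply: Or32].
  by apply: Or33; have [-> ->] := neq k q qs nk; have [-> ->] := neq l q qs nl.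
rewrite negb_or => /andP[/negbTE e1 /negbTE e2].
have hps : ((k, l) \in ps) || ((l, k) \in ps).
  by move: h; rewrite !(eq_sym _ pr) e1 e2.
have [kl pl hh] := IH u hps.
have kin : k \in pair_labels ps by case/orP: hps => /mem_pair_labels [].
have lin : l \in pair_labels ps by case/orP: hps => /mem_pair_labels [].
have p1k : (pr.1 == k) = false by apply/negbTE; apply: contraNneq n1 => ->.
have p2k : (pr.2 == k) = false by apply/negbTE; apply: contraNneq n2 => ->.
have p1l : (pr.1 == l) = false by apply/negbTE; apply: contraNneq n1 => ->.
have p2l : (pr.2 == l) = false by apply/negbTE; apply: contraNneq n2 => ->.
split=> //.
  rewrite p1k p2k /=; apply/permP => P; have /permP/(_ P) /= := pl.
  by rewrite /pair_labels /=; clear; lia.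
move=> q; rewrite inE => /predU1P[->|/hh//].
by apply: Or33; rewrite p1k p2k p1l p2l.
Qed.

(* Removes the labels [2n - 1] and [2n] from a matching of [2n] by joining
   their partners. *)
Definition close_up (n : nat) (g : nat -> nat) (x : nat) : nat :=
  if x == g (2 * n) then g (2 * n).-1
  else if x == g (2 * n).-1 then g (2 * n) else g x.

Lemma Psi'_pairs_nonroot n t : 2 <= n -> valid n t -> rootmark t = false ->
  pair_marks (marked_pairs (label_tree t)) = 1 ->
  exists k l, let ps := sib_pairs (label_tree t) in
   [/\ ((k, l) \in ps) || ((l, k) \in ps),
      Psi'_pairs t = [seq pr <- ps | ~~ ((pr.1 == k) || (pr.2 == k))]
                       ++ [:: (k, 2 * n); (l, (2 * n).-1)] &
      forall pr, pr \in marked_pairs (label_tree t) ->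
        pr.1.2 = (pr.1.1 == k) /\ pr.2.2 = (pr.2.1 == k)].
Proof.
move=> n2 vt rt pm; have pl := label_tree_labels n2 vt.
have [|k [l [h1 h2 h3]]] := one_marked_side pm.
  by rewrite (perm_uniq pl) iota_uniq.
exists k, l => /=; split=> //; first by rewrite sib_pairs_unmark.
rewrite /Psi'_pairs (label_tree_rootmark n2 vt) rt marked_sibE h1.
by rewrite -(size_leaves t) (perm_size vt) size_iota.
Qed.

Lemma Psi'_pairs_root n t : 2 <= n -> valid n t -> rootmark t ->
  Psi'_pairs t = rcons (sib_pairs (label_tree t)) ((2 * n).-1, 2 * n).
Proof.
move=> n2 vt rt; rewrite /Psi'_pairs (label_tree_rootmark n2 vt) rt.
by rewrite -(size_leaves t) (perm_size vt) size_iota.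
Qed.

Lemma pair_labels_cat ps qs : pair_labels (ps ++ qs) = pair_labels ps ++ pair_labels qs.
Proof. by rewrite /pair_labels map_cat flatten_cat. Qed.

Lemma valid1 t : valid 1 t -> exists m, t = Lf m 1.
Proof.
move=> vt; have sl := perm_size vt; case: t vt sl => [m l|m a b] /=.
  by rewrite /valid /= => /perm_mem /(_ l); rewrite !inE eqxx => /esym/eqP -> ; exists m.
by rewrite size_cat; have := leaves_gt0 a; have := leaves_gt0 b; lia.
Qed.

Lemma Psi'_labels n t : 1 <= n -> valid n t -> nmarks t = 1 ->
  perm_eq (pair_labels (Psi'_pairs t)) (iota 1 (2 * n)).
Proof.
(* A single leaf has no cherry and hence no run, so [n = 1] is computed directly. *)
rewrite leq_eqVlt => /predU1P[<-|n2] vt m1.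
  by have [[] e] := valid1 vt; rewrite e in m1 *.
have pl := sib_pairs_labels n2 vt.
have -> : iota 1 (2 * n) = iota 1 (2 * n - 2) ++ [:: (2 * n).-1; 2 * n].
  have -> : 2 * n = (2 * n - 2) + 2 by lia.
  by rewrite iotaD /= addnK; congr (_ ++ [:: _; _]); lia.
have := label_tree_marks n2 vt; rewrite m1.
case rt : (rootmark t) => pm.
  by rewrite (Psi'_pairs_root n2 vt rt) -cats1 pair_labels_cat perm_cat2r.
have [|k [l [h1 -> h3]]] := Psi'_pairs_nonroot n2 vt rt; first by lia.
have [|kl pp _] := pair_labels_sep _ h1; first by rewrite (perm_uniq pl) iota_uniq.
rewrite pair_labels_cat; apply/permP => P; have /permP/(_ P) := pl; have /permP/(_ P) := pp.
by rewrite !count_cat /=; clear; lia.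
Qed.

(** The partner of [2n] carries all the information on the mark. If it is [2n - 1], the root is
    marked; then [pred1] selects no label of the tree and [close_up] changes nothing on these
    labels. Otherwise it is the marked label, and [close_up] rejoins it with its sibling. *)
Lemma Psi'_agrees n t g : 2 <= n -> valid n t -> nmarks t = 1 ->
  all (matches g) (Psi'_pairs t) ->
  all (agrees (close_up n g) (pred1 (g (2 * n)))) (marked_pairs (label_tree t))
  /\ rootmark t = (g (2 * n) == (2 * n).-1).
Proof.
move=> n2 vt m1; have pl := sib_pairs_labels n2 vt.
have lt2 q : q \in sib_pairs (label_tree t) -> q.1 <= 2 * n - 2 /\ q.2 <= 2 * n - 2.
  case/mem_pair_labels; rewrite !(perm_mem pl) !mem_iota => /andP[_ h1] /andP[_ h2].
  by split; rewrite -ltnS -[in ltnRHS]add1n.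
have := label_tree_marks n2 vt; rewrite m1.
case rt : (rootmark t) => pm.
  rewrite (Psi'_pairs_root n2 vt rt) all_rcons => /andP[/andP[/eqP /= g1 /eqP g2] /allP ag].
  rewrite g2 eqxx; split=> //; apply/allP => q qs.
  have p0 : pair_marks (marked_pairs (label_tree t)) = 0 by lia.
  have qs' : unmark q \in sib_pairs (label_tree t) by rewrite sib_pairs_unmark map_f.
  have [/= l1 l2] := lt2 _ qs'; have /andP[/= /eqP e1 /eqP e2] := ag _ qs'.
  have [m1' m2'] := pair_marks0 p0 qs.
  rewrite /agrees /close_up /= m1' m2' g1 g2.
  have ne x y : x <= 2 * n - 2 -> 2 * n - 2 < y -> (x == y) = false by lia.
  rewrite !(ne q.1.1) ?(ne q.2.1) ?e1 ?e2 ?eqxx //; lia.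
have [|k [l [h1 -> h3]]] := Psi'_pairs_nonroot n2 vt rt; first by lia.
have [|kl pp hh] := pair_labels_sep _ h1; first by rewrite (perm_uniq pl) iota_uniq.
rewrite all_cat /= andbT => /and3P[/allP ag /andP[/= /eqP gk /eqP g2n] /andP[/= /eqP gl /eqP g2n1]].
have kle : k <= 2 * n - 2 by case/orP: h1 => /lt2 [].
split; last by rewrite g2n; lia.
rewrite g2n; apply/allP => q qs.
have qs' : unmark q \in sib_pairs (label_tree t) by rewrite sib_pairs_unmark map_f.
have [e1 e2] := h3 q qs; rewrite /agrees /close_up /= g2n g2n1 e1 e2 !eqxx !andbT.
case: (hh _ qs') => [[-> ->]|[-> ->]|[/= /negbTE a1 /negbTE a2 /negbTE a3 /negbTE a4]].
- by rewrite !eqxx [l == k]eq_sym (negbTE kl) ?eqxx.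
- by rewrite !eqxx [l == k]eq_sym (negbTE kl) ?eqxx.
rewrite a1 a2 a3 a4; have := ag (unmark q).
by rewrite mem_filter /= a1 a3 qs'; apply.
Qed.

(** Converse of [Psi'_agrees]. When the root is unmarked, the marked label is the partner of [2n],
    and its sibling must be the partner of [2n - 1] because [close_up] joins these two; cutting
    their pair restores [g]. *)
Lemma agrees_Psi' n t g : 2 <= n -> valid n t ->
  (forall x, x \in iota 1 (2 * n) -> g x \in iota 1 (2 * n) /\ g (g x) = x /\ g x != x) ->
  all (agrees (close_up n g) (pred1 (g (2 * n)))) (marked_pairs (label_tree t)) ->
  rootmark t = (g (2 * n) == (2 * n).-1) ->
  nmarks t = 1 /\ all (matches g) (Psi'_pairs t).
Proof.
move=> n2 vt hg ag rt; have pl := sib_pairs_labels n2 vt.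
have pl' := label_tree_labels n2 vt.
have lt2 q : q \in sib_pairs (label_tree t) -> q.1 <= 2 * n - 2 /\ q.2 <= 2 * n - 2.
  case/mem_pair_labels; rewrite !(perm_mem pl) !mem_iota => /andP[_ h1] /andP[_ h2].
  by split; rewrite -ltnS -[in ltnRHS]add1n.
have [i2n [gg2n ng2n]] : _ := hg (2 * n) ltac:(rewrite mem_iota; lia).
have [i2n1 [gg2n1 ng2n1]] : _ := hg (2 * n).-1 ltac:(rewrite mem_iota; lia).
have pm := pair_marks_agrees ag; rewrite (permP pl') in pm.
have agm : all (matches (close_up n g)) (sib_pairs (label_tree t)).
  by rewrite sib_pairs_unmark; exact: agrees_matches ag.
rewrite (label_tree_marks n2 vt).
case E : (g (2 * n) == (2 * n).-1) in rt.
  move/eqP in E; rewrite (Psi'_pairs_root n2 vt rt) all_rcons.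
  have g1 : g (2 * n).-1 = 2 * n by rewrite -E.
  split.
    (* The selected label is [2n - 1], beyond the labels of the tree, so no mark is counted. *)
    rewrite rt pm E; apply/eqP; rewrite eqSS eqn0Ngt -has_count; apply/hasPn => x.
    by rewrite mem_iota /=; lia.
  rewrite /matches /= g1 E !eqxx /=; apply/allP => q qs.
  have [l1 l2] := lt2 q qs; have /andP[] := allP agm q qs; rewrite /close_up E g1.
  have ne x y : x <= 2 * n - 2 -> 2 * n - 2 < y -> (x == y) = false by lia.
  by rewrite !(ne q.1) ?(ne q.2) //; first [move=> -> -> //|lia].
have gle : g (2 * n) \in iota 1 (2 * n - 2).
  by move: i2n; rewrite !mem_iota; lia.
have pm1 : pair_marks (marked_pairs (label_tree t)) = 1.
  by rewrite pm (count_uniq_mem _ (iota_uniq _ _)) gle.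
split; first by rewrite rt pm1.
have [k [l [h1 -> h3]]] := Psi'_pairs_nonroot n2 vt rt pm1.
have [|kl pp hh] := pair_labels_sep _ h1; first by rewrite (perm_uniq pl) iota_uniq.
(* [g (2 * n)] occurs in some sibling pair, where [agrees] makes it a marked label, and [k] is the
   only one. *)
have ek : g (2 * n) = k.
  move: gle; rewrite -(perm_mem pl') => /flattenP[_ /mapP[q qs ->]]; rewrite !inE.
  have [e1 e2] := h3 q qs; have /and4P[_ _ /eqP /= b1 /eqP b2] := allP ag q qs.
  by case/orP => /eqP e; apply/eqP; [rewrite e -e1 -b1 e|rewrite e -e2 -b2 e]; apply/eqP.
have el : g (2 * n).-1 = l.
  case/orP: h1 => /(allP agm)/andP[/= /eqP b1 /eqP b2].
    by move: b1; rewrite /close_up ek eqxx.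
  by move: b2; rewrite /close_up ek eqxx.
have gk : g k = 2 * n by rewrite -ek.
have gl : g l = (2 * n).-1 by rewrite -el.
rewrite all_cat /= {2 3}/matches /= gk ek gl el !eqxx !andbT.
apply/allP => q; rewrite mem_filter negb_or => /andP[/andP[n1 n2'] qs].
have := allP agm q qs; rewrite /matches /close_up ek el (negbTE n1) (negbTE n2').
case: (hh q qs) => [e|e|[_ /negbTE -> _ /negbTE ->]] //.
  by rewrite e eqxx in n1.
by rewrite e eqxx in n2'.
Qed.

Lemma Psi'_matching n t : 1 <= n -> valid n t -> nmarks t = 1 ->
  is_matching (matching_of (2 * n) (Psi'_pairs t)).
Proof. by move=> n1 vt m1; apply: is_matching_of; apply: Psi'_labels. Qed.

Lemma Psi'_inj n t u : 1 <= n -> valid n t -> valid n u ->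
  nmarks t = 1 -> nmarks u = 1 ->
  matching_of (2 * n) (Psi'_pairs t) = matching_of (2 * n) (Psi'_pairs u) ->
  teq t u.
Proof.
move=> n1 vt vu mt mu e.
have at_ := matches_matching_of (Psi'_labels n1 vt mt).
have au := matches_matching_of (Psi'_labels n1 vu mu).
rewrite -e in au; move: n1; rewrite leq_eqVlt => /predU1P[en|n2].
  move: en vt vu mt mu {e at_ au} => <- /valid1[m ->] /valid1[m' ->].
  by case: m; case: m' => // _ _; apply: teq_refl.
have [a1 r1] := Psi'_agrees n2 vt mt at_; have [a2 r2] := Psi'_agrees n2 vu mu au.
by apply: (label_tree_inj n2 vt vu a1 a2); rewrite r1 r2.
Qed.

Lemma Psi'_teq n t u : 1 <= n -> valid n t -> nmarks t = 1 -> teq t u ->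
  matching_of (2 * n) (Psi'_pairs t) = matching_of (2 * n) (Psi'_pairs u).
Proof.
move=> n1 vt mt tu.
have vu : valid n u by rewrite /valid -(permPl (teq_leaves tu)).
have mu : nmarks u = 1 by rewrite -(teq_nmarks tu).
have at_ := matches_matching_of (Psi'_labels n1 vt mt).
apply/esym/matching_of_matches; first exact: Psi'_labels.
have mm := Psi'_matching n1 vt mt.
move: (n1); rewrite leq_eqVlt => /predU1P[en|n2].
  by move: vt tu at_ {mm}; rewrite -en => /valid1[m ->] T; inversion T.
have [a1 r1] := Psi'_agrees n2 vt mt at_.
apply: proj2 (agrees_Psi' n2 vu _ (label_tree_teq n2 vt tu a1) _).
  by move=> x /(nat_fun_matching mm)[].
by rewrite -(teq_rootmark tu).
Qed.

(** Either [2n - 1] and [2n] are partners, and [close_up] is [g] on the smaller labels, or their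
    partners are two different smaller labels, which get joined. *)
Lemma close_up_matching n g : 2 <= n ->
  (forall x, x \in iota 1 (2 * n) -> g x \in iota 1 (2 * n) /\ g (g x) = x /\ g x != x) ->
  forall x, x \in iota 1 (2 * n - 2) ->
    [/\ close_up n g x \in iota 1 (2 * n - 2), close_up n g (close_up n g x) = x &
        close_up n g x != x].
Proof.
move=> n2 hg x; rewrite !mem_iota => hx.
have [i2n [gg2n ng2n]] : _ := hg (2 * n) ltac:(rewrite mem_iota; lia).
have [i2n1 [gg2n1 ng2n1]] : _ := hg (2 * n).-1 ltac:(rewrite mem_iota; lia).
have [ix [ggx ngx]] : _ := hg x ltac:(rewrite mem_iota; lia).
rewrite !mem_iota in i2n i2n1 ix.
have n12 : g (2 * n) != g (2 * n).-1.
  by apply/eqP => e; have := gg2n1; rewrite -e gg2n; lia.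
rewrite /close_up.
case: (eqVneq x (g (2 * n))) => [ex|nx1].
  have n3 : g (2 * n).-1 != 2 * n.
    by apply/eqP => e; move: gg2n1; rewrite e -ex; lia.
  rewrite ![g (2 * n).-1 == _]eq_sym (negbTE n12) eqxx ex eq_sym n12; split=> //; lia.
case: (eqVneq x (g (2 * n).-1)) => [ex|nx2].
  have n3 : g (2 * n) != (2 * n).-1.
    by apply/eqP => e; move: gg2n; rewrite e -ex; lia.
  rewrite eqxx ex n12; split=> //; lia.
have m1 : g x != g (2 * n) by apply/eqP => e; move: ggx; rewrite e gg2n; lia.
have m2 : g x != g (2 * n).-1 by apply/eqP => e; move: ggx; rewrite e gg2n1; lia.
have m3 : g x != 2 * n by apply: contra_neq nx1 => <-.
have m4 : g x != (2 * n).-1 by apply: contra_neq nx2 => <-.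
rewrite (negbTE m1) (negbTE m2); split=> //; lia.
Qed.

Lemma Psi'_surj n f : 1 <= n -> is_matching f ->
  exists t, [/\ valid n t, nmarks t = 1 & matching_of (2 * n) (Psi'_pairs t) = f].
Proof.
move=> n1 mf.
have hg x : x \in iota 1 (2 * n) -> nat_fun f x \in iota 1 (2 * n) /\
   nat_fun f (nat_fun f x) = x /\ nat_fun f x != x.
  by move=> /(nat_fun_matching mf)[].
move: (n1); rewrite leq_eqVlt => /predU1P[en|n2].
  subst n; exists (Lf true 1); split=> //; apply: matching_of_matches => //.
  have [//|h1 [_ h2]] := hg 1; have [//|h3 [_ h4]] := hg 2.
  have e1 : nat_fun f 1 = 2 by move: h1 h2; rewrite !inE => /orP[]/eqP ->.
  have e2 : nat_fun f 2 = 1 by move: h3 h4; rewrite !inE => /orP[]/eqP ->.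
  by rewrite /Psi'_pairs /matches /= e1 e2.
have [t [vt ag rm]] := @label_tree_surj n (close_up n (nat_fun f)) (pred1 (nat_fun f (2 * n)))
  (nat_fun f (2 * n) == (2 * n).-1) n2 (close_up_matching n2 hg).
have [m1 am] := agrees_Psi' n2 vt hg ag rm.
exists t; split=> //; apply: matching_of_matches am; exact: Psi'_labels.
Qed.

(** * From Motzkin paths to trees *)

Definition edge_ok (x : int) (a b : nat) : bool :=
  [&& step_ok x, (x == -1)%R ==> (a < b) & (x == 1)%R ==> (b < a)].

(** Well-labelledness as a condition on consecutive labels, without reference to [[n]]: it can be
    cut at any step and is stable under reversal, so the two halves of a path inherit it with their
    own labels. *)
Fixpoint path_ok (p : seq int) (s : seq nat) : bool :=
  match p, s with
  | [::], [:: _] => true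
  | x :: p', a :: s' => edge_ok x a (head 0 s') && path_ok p' s'
  | _, _ => false
  end.

Definition revpath (p : seq int) : seq int := map (fun y => - y)%R (rev p).

Lemma path_ok_size p s : path_ok p s -> size s = (size p).+1.
Proof.
elim: p s => [|x p IH] [|a s] //=; first by case: s.
by case/andP=> _ /IH ->.
Qed.

Lemma path_ok_steps p s : path_ok p s -> all step_ok p.
Proof. by elim: p s => [|y p IH] [|b s] //= /andP[/and3P[-> _ _] /IH]. Qed.

Lemma path_ok_cat p1 x p2 s1 s2 : size s1 = (size p1).+1 ->
  path_ok (p1 ++ x :: p2) (s1 ++ s2) =
  [&& path_ok p1 s1, edge_ok x (last 0 s1) (head 0 s2) & path_ok p2 s2].
Proof.
elim: p1 s1 => [|y p1 IH] [|a s1] //= [ss]; first by case: s1 ss.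
case: s1 ss IH => //= b s1 ss IH.
by rewrite -/(path_ok (p1 ++ x :: p2) ((b :: s1) ++ s2)) (IH (b :: s1)) //= -!andbA.
Qed.

Lemma edge_ok_opp x a b : edge_ok (- x)%R b a = edge_ok x a b.
Proof.
rewrite /edge_ok /step_ok !GRing.eqr_oppLR GRing.oppr0 GRing.opprK.
by do 3 case: (x == _); case: (a < b); case: (b < a).
Qed.

Lemma path_ok_rev p s : path_ok p s -> path_ok (revpath p) (rev s).
Proof.
elim: p s => [|x p IH] [|a s] //=; first by case: s.
case/andP => he hp; have ss := path_ok_size hp.
rewrite /revpath !rev_cons map_rcons -!cats1 path_ok_cat; last first.
  by rewrite size_rev size_map size_rev.
by rewrite IH //= edge_ok_opp andbT; case: s he {hp ss IH} => //= b s; rewrite rev_cons last_rcons.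
Qed.

Lemma well_labelledE n p s : 0 < n ->
  well_labelled n p s = path_ok p s && perm_eq s (iota 1 n).
Proof.
move=> n0; rewrite /well_labelled.
case ps : (perm_eq s (iota 1 n)); last by rewrite !andbF.
have ss : size s = n by rewrite (perm_size ps) size_iota.
rewrite andbT /= -ss in n0 *; move: {ps n ss} n0.
elim: p s => [|x p IH] [|a s] //= _; first by case: s.
case: s => [|b s] //=; first by case: p {IH} => [|? ?] /=; rewrite andbF.
have := IH (b :: s) isT; rewrite /= eqSS => <-.
rewrite -[iota 1 _]/(iota (1 + 0) _) iotaDl all_map /edge_ok /=.
case: (_ == _) => //=; last by rewrite andbF.
set B := all _ (iota 0 _).
by case: (step_ok x); case: (all step_ok p); rewrite /= ?andbF ?andbT ?andbA.
Qed.

Lemma psum0 p : psum p 0 = 0%R.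
Proof. by rewrite /psum take0 big_nil. Qed.

Lemma psumS x p j : psum (x :: p) j.+1 = (x + psum p j)%R.
Proof. by rewrite /psum /= big_cons. Qed.

Lemma psum_catl p1 p2 j : j <= size p1 -> psum (p1 ++ p2) j = psum p1 j.
Proof.
move=> h; rewrite /psum take_cat ltn_neqAle h andbT.
by case: eqVneq => //= ->; rewrite subnn take0 cats0 take_size.
Qed.

Lemma psum_catr p1 p2 j : psum (p1 ++ p2) (size p1 + j) = (psum p1 (size p1) + psum p2 j)%R.
Proof.
rewrite /psum take_cat ltnNge leq_addr /= addKn big_cat /=.
by rewrite take_size.
Qed.

Lemma psum_cat1 p1 x p2 : psum (p1 ++ x :: p2) (size p1).+1 = (psum p1 (size p1) + x)%R.
Proof. by rewrite -addn1 psum_catr psumS psum0 GRing.addr0. Qed.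

Lemma psum_nth p j : j < size p -> psum p j.+1 = (psum p j + nth 0 p j)%R.
Proof.
by move=> h; rewrite /psum (take_nth 0%R) // -cats1 big_cat big_seq1.
Qed.

Lemma psum_rev p j : j <= size p ->
  psum (revpath p) j = (psum p (size p - j) - psum p (size p))%R.
Proof.
move=> h; rewrite /psum /revpath -map_take take_rev big_map GRing.sumrN take_size.
have -> : (\sum_(i <- rev (drop (size p - j) p)) i = \sum_(i <- drop (size p - j) p) i)%R.
  by apply: perm_big; rewrite perm_rev.
rewrite -[X in (_ = _ - \sum_(x <- X) _)%R](cat_take_drop (size p - j)) big_cat /=.
by rewrite GRing.opprD GRing.addrA GRing.subrr GRing.add0r.
Qed.

Lemma size_revpath p : size (revpath p) = size p.
Proof. by rewrite size_map size_rev. Qed.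

Lemma revpathK : involutive revpath.
Proof.
move=> p; rewrite /revpath -map_rev revK -map_comp -[RHS]map_id.
by apply: eq_map => x /=; rewrite GRing.opprK.
Qed.

(** * Shapes of paths and the cutting indices *)

Definition first_passage (p : seq int) : Prop :=
  (forall j, j < size p -> (0 <= psum p j)%R) /\ psum p (size p) = (-1)%R.

(** The image of [first_passage] under [revpath]; the part of a path before the step at which [Phi]
    or [Phi'] cuts has this shape. *)
Definition last_passage (p : seq int) : Prop :=
  (forall j, 0 < j <= size p -> (1 <= psum p j)%R) /\ psum p (size p) = 1%R.

Definition nonneg_path (p : seq int) : Prop :=
  forall j, j <= size p -> (0 <= psum p j)%R.

Lemma first_passage_rev p : first_passage p -> last_passage (revpath p).
Proof.
case=> h1 h2; split=> [j|]; rewrite size_revpath.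
  by move=> /andP[j0 js]; rewrite psum_rev //; have := h1 (size p - j); lia.
by rewrite psum_rev // subnn psum0 h2.
Qed.

Lemma last_passage_rev p : last_passage p -> first_passage (revpath p).
Proof.
case=> h1 h2; split=> [j|]; rewrite size_revpath.
  by move=> js; rewrite psum_rev ?(ltnW js) //; have := h1 (size p - j); lia.
by rewrite psum_rev // subnn psum0 h2.
Qed.

Lemma last_passage_size r : last_passage r -> 0 < size r.
Proof. by case: r => // -[_]; rewrite psum0. Qed.

(** Such a path begins with an up-step, so [Phi] and [Phi'] take their splitting branch on it. *)
Lemma last_passage_head r p x q : last_passage r -> r ++ p = x :: q -> (x == 0%R) = false.
Proof.
move=> hr; have := last_passage_size hr; case: hr => h1 _.
case: r h1 => // y r h1 _ [<- _]; have := h1 1 isT.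
by rewrite psumS psum0 GRing.addr0; lia.
Qed.

Lemma first_passage_cat r q : last_passage r -> first_passage q ->
  first_passage (r ++ (-1)%R :: q).
Proof.
case=> r1 r2 [q1 q2]; split=> [j|]; last first.
  by rewrite size_cat psum_catr r2 /= psumS q2.
rewrite size_cat /= => hj; case: (leqP j (size r)) => jr.
  rewrite psum_catl //; case: j jr {hj} => [|j] jr; first by rewrite psum0.
  by have := r1 j.+1; lia.
have -> : j = size r + (j - size r).-1.+1 by lia.
rewrite psum_catr r2 psumS; have := q1 (j - size r).-1; lia.
Qed.

Lemma nonneg_path_cat r x q : last_passage r -> (-1 <= x)%R -> nonneg_path q ->
  nonneg_path (r ++ x :: q).
Proof.
case=> r1 r2 hx q1 j; rewrite size_cat /= => hj; case: (leqP j (size r)) => jr.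
  rewrite psum_catl //; case: j jr {hj} => [|j] jr; first by rewrite psum0.
  by have := r1 j.+1; lia.
have -> : j = size r + (j - size r).-1.+1 by lia.
rewrite psum_catr r2 psumS; have := q1 (j - size r).-1; lia.
Qed.

Lemma find_iota (P : pred nat) k N : k < N -> P k.+1 ->
  (forall j, j < k -> ~~ P j.+1) -> find P (iota 1 N) = k.
Proof.
move=> kN Pk hP.
have -> : N = k + (N - k).-1.+1 by lia.
rewrite iotaD find_cat /= add1n Pk size_iota addn0 ifF //.
by apply/hasPn => -[|x]; rewrite mem_iota //; rewrite add1n ltnS => /hP.
Qed.

(** The heights along [r] are at least 1 after the start and end at 1, so the following down-step is
    the first return to 0. *)
Lemma kmin_cat r q : last_passage r -> kmin (r ++ (-1)%R :: q) = (size r).+1.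
Proof.
case=> r1 r2; rewrite /kmin; congr _.+1; apply: find_iota.
- by rewrite size_cat /= addnS ltnS leq_addr.
- by rewrite psum_cat1 r2.
- by move=> j jr; rewrite psum_catl //; have := r1 j.+1; lia.
Qed.

Lemma last_filter_iota (P : pred nat) k N : 2 <= k <= N.+1 -> P k ->
  (forall j, k < j <= N.+1 -> ~~ P j) -> last 0 [seq x <- iota 2 N | P x] = k.
Proof.
move=> /andP[k2 kN] Pk hP.
have -> : N = (k - 2) + (N.+1 - k).+1 by lia.
rewrite iotaD filter_cat last_cat /= subnKC // Pk /=.
rewrite (_ : [seq x <- iota k.+1 (N.+1 - k) | P x] = [::]) //.
apply/eqP; rewrite -(negbK (_ == _)) -has_filter; apply/hasPn => x.
by rewrite mem_iota => hx; apply: hP; lia.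
Qed.

Lemma kmax_condP p k : 2 <= k -> reflect
  ((forall j, 0 < j -> j.+1 < k -> (1 <= psum p j)%R) /\ psum p k.-1 = 1%R)
  (kmax_cond p k).
Proof.
move=> k2; apply: (iffP andP) => -[h1 /eqP h2]; split=> //.
- move=> j j0 jk; move/allP: h1 => /(_ j.+1); apply; rewrite mem_iota; lia.
- apply/allP => -[|[|j]]; rewrite mem_iota // => hj; apply: h1 => //; lia.
Qed.

Lemma kmax_full r : last_passage r -> kmax (size r).+1 r = (size r).+1.
Proof.
move=> hr; have r0 := last_passage_size hr; case: hr => r1 r2.
rewrite /kmax; apply: last_filter_iota => /=; first by lia.
  by apply/kmax_condP => //; split=> // j j0 jr; apply: r1; lia.
by move=> j; lia.
Qed.

(** No later index qualifies. After an up-step the height is at least 2 for good, as [q] stays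
    nonnegative. After a down-step the height is 0, which is excluded both as an intermediate and as
    a final height. *)
Lemma kmax_cat r x q : last_passage r -> x = (-1)%R \/ x = 1%R -> nonneg_path q ->
  kmax (size (r ++ x :: q)).+1 (r ++ x :: q) = (size r).+1.
Proof.
move=> hr hx hq; have r0 := last_passage_size hr; case: hr => r1 r2.
rewrite /kmax; apply: last_filter_iota => /=.
- by rewrite size_cat /=; lia.
- apply/kmax_condP => //; rewrite /= psum_catl //; split=> // j j0 jr.
  by rewrite psum_catl; [apply: r1|]; lia.
move=> j; rewrite size_cat /= => hj; apply/negP => /kmax_condP.
case; [lia|]; move=> c1 c2.
have E : j.-1 = size r + (j.-1 - size r).-1.+1 by lia.
rewrite E psum_catr r2 psumS in c2; have h0 := hq (j.-1 - size r).-1.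
case: hx => ex; last by rewrite ex in c2; lia.
case: (ltngtP j (size r).+2) => hj2; try lia.
- have := c1 (size r).+1; rewrite psum_cat1 r2 ex; lia.
- move: c2; rewrite hj2 /= subSn // subnn /= psum0 ex; lia.
Qed.

(** The graph of [Phi], with the actual labels in place of their standardisations. In [mot1] the
    first factor is traversed backwards, so [head 0 s1] is the label just before the down-step and
    the inequality is the label condition there. *)
Inductive mot : seq int -> seq nat -> tree -> Prop :=
  | mot2 a b : a < b -> mot [:: (-1)%R] [:: a; b] (Nd false (Lf false a) (Lf false b))
  | mot0 a p s t : a \notin s -> mot p s t ->
      mot (0%R :: p) (a :: s) (Nd false (Lf false a) t)
  | mot1 p1 s1 t1 p2 s2 t2 : mot p1 s1 t1 -> mot p2 s2 t2 -> uniq (s1 ++ s2) ->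
      head 0 s1 < head 0 s2 ->
      mot (revpath p1 ++ (-1)%R :: p2) (rev s1 ++ s2) (Nd false t1 t2).

(** The graph of [Phi'], again with the actual labels. The step between the parts in [pos_sub] is
    not level: a level step would stay at height 1 and the cut would come later. Its sign is then
    dictated by the labels around it. *)
Inductive pos : seq int -> seq nat -> tree -> Prop :=
  | pos1 a : pos [::] [:: a] (Lf true a)
  | pos0 a p s t : a \notin s -> pos p s t ->
      pos (0%R :: p) (a :: s) (Nd false (Lf false a) t)
  | pos_root p s t : mot p s t -> pos (revpath p) (rev s) (setmark t)
  | pos_sub p1 s1 t1 p2 s2 t2 : mot p1 s1 t1 -> pos p2 s2 t2 -> uniq (s1 ++ s2) ->
      pos (revpath p1 ++ (if head 0 s1 < head 0 s2 then (-1)%R else 1%R) :: p2)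
          (rev s1 ++ s2) (Nd false t1 t2).

Lemma last_rev (s : seq nat) : last 0 (rev s) = head 0 s.
Proof. by case: s => //= a s; rewrite rev_cons last_rcons. Qed.

Lemma mot_node p s t : mot p s t -> exists a b, t = Nd false a b.
Proof. by case=> *; eexists; eexists. Qed.

Lemma mot_leaves p s t : mot p s t -> perm_eq (leaves t) s.
Proof.
elim=> //= [a {}p {}s {}t _ _ IH|p1 s1 t1 p2 s2 t2 _ h1 _ h2 _ _].
  by rewrite perm_cons.
by apply: perm_cat => //; rewrite perm_sym perm_rev perm_sym.
Qed.

Lemma mot_nmarks p s t : mot p s t -> nmarks t = 0.
Proof. by elim=> //= p1 s1 t1 p2 s2 t2 _ -> _ ->. Qed.

Lemma mot_first_passage p s t : mot p s t -> first_passage p.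
Proof.
elim=> [a b _|a {}p {}s {}t _ _ [h1 h2]|p1 s1 t1 p2 s2 t2 _ h1 _ h2 _ _].
- by split=> [[|j]|] //=; rewrite ?psumS psum0.
- split=> [[|j]|] /=; rewrite ?psum0 ?psumS ?GRing.add0r //; exact: h1.
- by apply: first_passage_cat => //; apply: first_passage_rev.
Qed.

Lemma mot_path_ok p s t : mot p s t -> path_ok p s.
Proof.
elim=> [a b ab|a {}p {}s {}t _ _ h|p1 s1 t1 p2 s2 t2 _ h1 _ h2 _ hh] //=.
  by rewrite /edge_ok /= ab.
rewrite path_ok_cat; last by rewrite size_rev size_revpath (path_ok_size h1).
by rewrite path_ok_rev // h2 last_rev /edge_ok /= hh.
Qed.

Lemma uniq_rev_cat (s1 s2 : seq nat) : uniq (rev s1 ++ s2) = uniq (s1 ++ s2).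
Proof.
by rewrite !cat_uniq rev_uniq; congr [&& _, ~~ _ & _]; apply: eq_has => x; rewrite /= mem_rev.
Qed.

Lemma mot_total p s : first_passage p -> path_ok p s -> uniq s ->
  exists t, mot p s t.
Proof.
move: {2}(size p) (leqnn (size p)) => N.
elim: N p s => [|N IH] p s; first by case: p => // _ [_]; rewrite psum0.
case: p => [|x p]; first by move=> _ [_]; rewrite psum0.
case: s => [|a s] // sN fp /andP[he hp] /andP[an us].
have [ex|[ex|ex]] : x = (-1)%R \/ x = 0%R \/ x = 1%R.
  by case/and3P: he => /or3P[]/eqP -> _ _; [left|right; left|right; right].
- subst x; case: p fp sN hp => [_ _|y p [/(_ 1 isT)]]; last first.
    by rewrite psumS psum0.
  case: s he {an us} => // b [] //= /and3P[_ ab _] _.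
  by exists (Nd false (Lf false a) (Lf false b)); constructor.
- subst x; have [|t ht] := IH p s sN _ hp us.
    case: fp => h1 h2; split=> [j js|]; last by move: h2; rewrite /= psumS GRing.add0r.
    by have := h1 j.+1 js; rewrite psumS GRing.add0r.
  by exists (Nd false (Lf false a) t); constructor.
(* The least such [j] is the return to 0; one exists because the path ends at -1. *)
have hP : exists j, (0 < j) && (psum (x :: p) j <= 0)%R.
  by exists (size (x :: p)); case: fp => _ ->.
case: (ex_minnP hP) => k /andP[k0 psk] kmin_.
have hk : psum (x :: p) 1 = 1%R by rewrite psumS psum0 ex.
have k1 : 1 < k by case: k k0 psk {kmin_} => [|[|k]] //; rewrite hk.
set P := x :: p in sN fp hP kmin_ psk hk *.
have pok : path_ok P (a :: s) by rewrite /= he.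
have kP : k <= size P by apply: kmin_; case: fp => _ ->.
have r1 j : 0 < j < k -> (1 <= psum P j)%R.
  by move=> /andP[j0 jk]; have := kmin_ j; rewrite j0; lia.
have kp : k.-1 < size P by lia.
have pk := psum_nth kp; rewrite prednK // in pk.
(* Steps go down by at most 1, so the path arrives at height exactly 0, by a down-step from height
   1. *)
have st : (-1 <= nth 0 P k.-1)%R.
  by have /allP /(_ _ (mem_nth 0%R kp)) := path_ok_steps pok => /or3P[]/eqP ->.
have e1 : psum P k.-1 = 1%R by have := r1 k.-1; lia.
have e2 : nth 0%R P k.-1 = (-1)%R by have := r1 k.-1; lia.
have e0 : psum P k = 0%R by lia.
(* The end height is -1 and not 0, so a nonempty path remains after the return. *)
have kP' : k < size P.
  by rewrite ltn_neqAle kP andbT; apply/eqP => e; case: fp; rewrite -e e0.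
have EP : P = take k.-1 P ++ (-1)%R :: drop k P.
  by rewrite -e2 -[k in drop k]prednK // -drop_nth // cat_take_drop.
set r := take k.-1 P in EP; set q := drop k P in EP.
have sr : size r = k.-1 by rewrite size_takel // ltnW.
have hr : last_passage r.
  split; rewrite sr.
    by move=> j /andP[j0 jk]; have := r1 j; rewrite EP psum_catl ?sr //; lia.
  by rewrite -e1 EP psum_catl ?sr.
have hq : first_passage q.
  have ek j : psum P (k + j) = psum q j.
    have -> : k + j = size r + j.+1 by rewrite sr; lia.
    by rewrite EP psum_catr psumS; case: hr => _ ->; lia.
  have sq : size P = k + size q by rewrite size_drop; lia.
  case: fp => f1 f2; split=> [j jq|]; last by rewrite -ek -sq.
  by rewrite -ek; apply: f1; rewrite sq ltn_add2l.
set S := a :: s in pok *; have sS := path_ok_size pok.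
have ES : S = take k S ++ drop k S by rewrite cat_take_drop.
have stk : size (take k S) = (size r).+1 by rewrite size_takel ?sr ?sS; lia.
have /and3P[o1 /and3P[_ /= o2 _] o3] :
    [&& path_ok r (take k S), edge_ok (-1)%R (last 0 (take k S)) (head 0 (drop k S))
      & path_ok q (drop k S)].
  by rewrite -path_ok_cat // -EP -ES.
have uS : uniq (take k S ++ drop k S) by rewrite -ES /= an.
have [u1 _ u2] := and3P (etrans (esym (cat_uniq _ _)) uS).
have [||||t1 m1] := IH (revpath r) (rev (take k S)).
- by rewrite size_revpath sr; lia.
- exact: last_passage_rev.
- exact: path_ok_rev.
- by rewrite rev_uniq.
have [||||t2 m2] := IH q (drop k S) => //.
- by rewrite size_drop; lia.
exists (Nd false t1 t2).
have -> : P = revpath (revpath r) ++ (-1)%R :: q by rewrite revpathK -EP.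
have -> : S = rev (rev (take k S)) ++ drop k S by rewrite revK -ES.
constructor=> //; last by rewrite -last_rev revK.
by rewrite uniq_rev_cat.
Qed.

(** The number of leaves among the children of the root (two, one or none) tells the three rules
    apart, since [mot] produces only internal nodes. Exchanging the children is impossible in the
    two rules with a strict inequality, as it would reverse the inequality. *)
Lemma mot_teq_inj p s t p' s' t' : mot p s t -> mot p' s' t' -> teq t t' ->
  p = p' /\ s = s'.
Proof.
move=> m; elim: m p' s' t' => [a b ab|a {}p {}s {}t _ mt IH
  |p1 s1 t1 p2 s2 t2 m1 IH1 m2 IH2 _ hh] p' s' t' [a' b' ab'|a' q u v _ mv
  |q1 u1 v1 q2 u2 v2 n1 n2 _ hh'] T;
  inversion T as [|? ? ? ? ? T1 T2|? ? ? ? ? T1 T2]; subst.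
- by inversion T1; inversion T2; subst.
- by inversion T1; inversion T2; subst; lia.
- by have [? [? e]] := mot_node mv; subst; inversion T2.
- by have [? [? e]] := mot_node mv; subst; inversion T1.
- by have [? [? e]] := mot_node n2; subst; inversion T2.
- by have [? [? e]] := mot_node n2; subst; inversion T1.
- by have [? [? e]] := mot_node mt; subst; inversion T2.
- by have [? [? e]] := mot_node mt; subst; inversion T2.
- by have [-> ->] := IH _ _ _ mv T2; inversion T1.
- by have [? [? e]] := mot_node mt; subst; inversion T2.
- by have [? [? e]] := mot_node n1; subst; inversion T1.
- by have [? [? e]] := mot_node n2; subst; inversion T1.
- by have [? [? e]] := mot_node m1; subst; inversion T1.
- by have [? [? e]] := mot_node m2; subst; inversion T2.
- by have [? [? e]] := mot_node m1; subst; inversion T1.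
- by have [? [? e]] := mot_node m2; subst; inversion T2.
- by have [-> ->] := IH1 _ _ _ n1 T1; have [-> ->] := IH2 _ _ _ n2 T2.
- have [_ e1] := IH1 _ _ _ n2 T1; have [_ e2] := IH2 _ _ _ n1 T2.
  by subst; lia.
Qed.

Lemma head_mem (s : seq nat) : 0 < size s -> head 0 s \in s.
Proof. by case: s => // a s _; rewrite mem_head. Qed.

Lemma mot_surj t : nmarks t = 0 -> uniq (leaves t) -> 2 <= size (leaves t) ->
  exists p s t', mot p s t' /\ teq t t'.
Proof.
elim: t => //= m a IHa b IHb /eqP; rewrite !addn_eq0 cat_uniq.
case: m => //= /andP[/eqP ma /eqP mb] /and3P[ua /hasPn hab ub] _.
have nd U : match U with Lf _ _ => True | Nd _ _ _ => 2 <= size (leaves U) end.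
  by case: U => //= _ U1 U2; rewrite size_cat; have := leaves_gt0 U1; have := leaves_gt0 U2; lia.
have := nd a; have := nd b.
case: a ma IHa ua hab => [m x|m a1 a2] ma IHa ua hab;
case: b mb IHb ub hab => [m' y|m' b1 b2] mb IHb ub hab sb sa.
- case: m m' ma mb ua ub hab {IHa IHb sa sb} => [] [] // _ _ _ _ hab.
  have := hab y; rewrite !inE eqxx => /(_ isT) nxy.
  case: (ltngtP x y) nxy => // xy _.
    exists [:: (-1)%R], [:: x; y], (Nd false (Lf false x) (Lf false y)).
    by split; [constructor|apply: teq_refl].
  exists [:: (-1)%R], [:: y; x], (Nd false (Lf false y) (Lf false x)).
  by split; [constructor|apply: teq_swap; apply: teq_refl].
- case: m ma ua hab {IHa sa} => // _ _ hab; have [p [s [t' [mt T]]]] := IHb mb ub sb.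
  exists (0%R :: p), (x :: s), (Nd false (Lf false x) t').
  split; last by apply: teq_node => //; apply: teq_refl.
  constructor=> //; rewrite -(perm_mem (mot_leaves mt)) -(perm_mem (teq_leaves T)).
  by apply/negP => /hab; rewrite inE eqxx.
- case: m' mb ub hab {IHb sb} => // _ _ hab; have [p [s [t' [mt T]]]] := IHa ma ua sa.
  exists (0%R :: p), (y :: s), (Nd false (Lf false y) t').
  split; last by apply: teq_swap => //; apply: teq_refl.
  constructor=> //; rewrite -(perm_mem (mot_leaves mt)) -(perm_mem (teq_leaves T)).
  by apply: hab; rewrite inE.
have [p1 [s1 [t1 [mt1 T1]]]] := IHa ma ua sa.
have [p2 [s2 [t2 [mt2 T2]]]] := IHb mb ub sb.
have l1 := perm_trans (teq_leaves T1) (mot_leaves mt1).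
have l2 := perm_trans (teq_leaves T2) (mot_leaves mt2).
have us : uniq (s1 ++ s2).
  rewrite -(perm_uniq (perm_cat l1 l2)) cat_uniq ua ub andbT.
  exact/hasPn.
have us' : uniq (s2 ++ s1) by rewrite uniq_catC.
have h1 : head 0 s1 \in s1 by apply: head_mem; rewrite -(perm_size l1); apply: leaves_gt0.
have h2 : head 0 s2 \in s2 by apply: head_mem; rewrite -(perm_size l2); apply: leaves_gt0.
case: (ltngtP (head 0 s1) (head 0 s2)) => hh.
- do 3 eexists; split; first exact: (mot1 mt1 mt2 us hh).
  exact: teq_node.
- do 3 eexists; split; first exact: (mot1 mt2 mt1 us' hh).
  exact: teq_swap.
exfalso; move: us; rewrite cat_uniq => /and3P[_ /hasPn/(_ _ h2)].
by rewrite -hh /= h1.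
Qed.

(** * Standardisation of labels *)

Lemma sorted_uniq_sort (I : seq nat) : uniq I -> sorted ltn (sort leq I).
Proof.
by move=> u; rewrite ltn_sorted_uniq_leq sort_uniq u; apply: sort_sorted; apply: leq_total.
Qed.

Lemma laminvK (I : seq nat) x : x \in I -> lam I (laminv I x) = x.
Proof. by move=> xI; rewrite /lam /laminv /= nth_index // mem_sort. Qed.

Lemma laminv_mono (I : seq nat) : uniq I ->
  {in I &, {mono laminv I : x y / x < y}}.
Proof.
move=> u x y xI yI; rewrite /laminv ltnS -/(ltn _ _).
have so := sorted_uniq_sort u; set S := sort leq I in so *.
have xS : x \in S by rewrite mem_sort.
have yS : y \in S by rewrite mem_sort.
have si := sorted_ltn_index ltn_trans so.
apply/idP/idP => [/(si _ _ xS yS)//|xy].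
case: (ltngtP (index x S) (index y S)) => // h.
  by have := si _ _ yS xS h => /=; lia.
by have := nth_index 0 xS; rewrite h nth_index // => e; rewrite e ltnn in xy.
Qed.

Lemma laminv_perm (I s : seq nat) : uniq I -> perm_eq s I ->
  perm_eq (map (laminv I) s) (iota 1 (size s)).
Proof.
move=> u p.
have p' : perm_eq s (sort leq I) by rewrite (permPl p) perm_sym perm_sort.
rewrite (permPl (perm_map _ p')) (perm_size p') /laminv.
have us : uniq (sort leq I) by rewrite sort_uniq.
set S := sort leq I in us *.
have -> : [seq (index x S).+1 | x <- S] = iota 1 (size S); last by [].
apply: (@eq_from_nth _ 0); rewrite size_map ?size_iota // => i iS.
by rewrite (nth_map 0) // index_uniq // nth_iota.
Qed.

(** Standardising a word on the whole of [[n]] changes nothing. This is the case [k = n] of [Phi'],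
    where no outer [lam] undoes the standardisation. *)
Lemma laminv_iota n I x : perm_eq I (iota 1 n) -> x \in I -> laminv I x = x.
Proof.
move=> p xI; have -> : laminv I x = (index x (iota 1 n)).+1.
  congr (index _ _).+1; apply: (sorted_eq leq_trans anti_leq).
  - exact: (sort_sorted leq_total).
  - exact: iota_sorted.
  - by rewrite perm_sort.
move: xI; rewrite (perm_mem p) mem_iota => /andP[x0 xn].
have xn' : x.-1 < n by lia.
have hx : nth 0 (iota 1 n) x.-1 = x by rewrite nth_iota // add1n prednK.
by rewrite -{1}hx index_uniq ?iota_uniq ?size_iota // prednK.
Qed.

Lemma relabel_comp f g t : relabel f (relabel g t) = relabel (f \o g) t.
Proof. by elim: t => //= m a -> b ->. Qed.

Lemma eq_relabel f g t : {in leaves t, f =1 g} -> relabel f t = relabel g t.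
Proof.
elim: t => /= [m l h|m a IHa b IHb h]; first by rewrite h // inE.
by rewrite IHa ?IHb // => x hx; apply: h; rewrite mem_cat hx ?orbT.
Qed.

Lemma relabel_id t : relabel id t = t.
Proof. by elim: t => //= m a -> b ->. Qed.

Lemma relabel_setmark f t : relabel f (setmark t) = setmark (relabel f t).
Proof. by case: t. Qed.

(* [F] computes the image of a path from its standardisation; composing with
   [lam I] undoes the standardisation. *)
Lemma relabel_lam (F : seq nat -> tree) (I s : seq nat) t g :
  (forall h, perm_eq (map h s) (iota 1 (size s)) ->
     {in s &, {mono h : x y / x < y}} -> F (map h s) = relabel h t) ->
  uniq I -> perm_eq (map g s) I -> {in s &, {mono g : x y / x < y}} ->
  perm_eq (leaves t) s ->
  relabel (lam I) (F (map (laminv I) (map g s))) = relabel g t.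
Proof.
move=> hF uI pI mg pt.
have inI x : x \in s -> g x \in I by move=> xs; rewrite -(perm_mem pI) map_f.
rewrite -map_comp hF.
- rewrite relabel_comp; apply: eq_relabel => x; rewrite (perm_mem pt) => xs /=.
  by rewrite laminvK // inI.
- by rewrite map_comp -(size_map g s); apply: laminv_perm.
- by move=> x y xs ys /=; rewrite (laminv_mono uI) ?inI // mg.
Qed.

Lemma mono_sub (s1 s2 : seq nat) (g : nat -> nat) : {subset s1 <= s2} ->
  {in s2 &, {mono g : x y / x < y}} -> {in s1 &, {mono g : x y / x < y}}.
Proof. by move=> h mg x y xs ys; apply: mg; apply: h. Qed.

Lemma size_mot p s t : mot p s t -> size s = (size p).+1.
Proof. by move/mot_path_ok/path_ok_size. Qed.

Lemma mot_size p s t : mot p s t -> 2 <= size s.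
Proof. by move=> m; rewrite (size_mot m); case: m => //= *; rewrite ?size_cat /=; lia. Qed.

(** Recursive calls receive restandardised labels, so the induction ranges over all increasing [g]
    that send the labels of the path onto an initial interval: [Phi] depends on the labels only
    through their order. *)
Lemma mot_Phi_f p s t fuel g : mot p s t -> size s <= fuel ->
  perm_eq (map g s) (iota 1 (size s)) -> {in s &, {mono g : x y / x < y}} ->
  Phi_f fuel p (map g s) = relabel g t.
Proof.
move=> m; elim: m fuel g => [a b ab|a {}p {}s {}t an mt IH
  |p1 s1 t1 p2 s2 t2 m1 IH1 m2 IH2 us hh] [|fuel] g //.
- move=> _ pg mg /=.
  have := mg a b; rewrite !inE !eqxx orbT ab => /(_ isT isT) gab.
  have := perm_mem pg (g a); have := perm_mem pg (g b).
  rewrite /= !inE !eqxx !orbT /= => /esym hb /esym ha.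
  by congr (Nd _ (Lf _ _) (Lf _ _)); lia.
- rewrite /= ltnS => sf pg mg; have s2 := mot_size mt.
  rewrite size_map ltnNge s2 /=; congr Nd.
  have pJ : perm_eq (map g s) (rem (g a) (1 :: iota 2 (size s))).
    rewrite -(perm_cons (g a)) (permPl pg); apply: perm_to_rem.
    by rewrite -(perm_mem pg) mem_head.
  apply: (relabel_lam (F := Phi_f fuel p)) => //.
  + by move=> h ph mh; apply: IH.
  + exact: (rem_uniq (g a) (iota_uniq 1 (size s).+1)).
  + by apply: mono_sub mg => x xs; rewrite inE xs orbT.
  + exact: mot_leaves mt.
  (* The splitting case without fuel: excluded, since [s1] alone has two labels. *)
  by rewrite size_cat size_rev; have := mot_size m1; lia.
rewrite size_cat size_rev => sf pg mg.
have z1 := mot_size m1; have z2 := mot_size m2.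
have lr := first_passage_rev (mot_first_passage m1).
have sr : (size (revpath p1)).+1 = size s1 by rewrite size_revpath (size_mot m1).
have ug : uniq (map g (rev s1 ++ s2)) by rewrite (perm_uniq pg) iota_uniq.
rewrite /= size_map size_cat size_rev leqNgt (_ : 2 < size s1 + size s2) //=; last by lia.
case Ep : (revpath p1 ++ (-1)%R :: p2) => [|x q]; first by case: (revpath p1) Ep.
rewrite (last_passage_head lr Ep) -Ep kmin_cat // sr map_cat.
rewrite take_size_cat ?size_map ?size_rev // drop_size_cat ?size_map ?size_rev //.
(* Injectivity of the successor gives the value of [k.-1], which stands here as the search inside
   [kmin]. *)
have [-> ] := kmin_cat p2 lr; rewrite take_size_cat //.
have -> : drop (size s1) (revpath p1 ++ (-1)%R :: p2) = p2.
  by rewrite -sr -cat_rcons drop_size_cat // size_rcons.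
rewrite -/(revpath (revpath p1)) revpathK -map_rev revK.
move: ug; rewrite map_cat cat_uniq => /and3P[u1 _ u2].
congr Nd.
- apply: (relabel_lam (F := Phi_f fuel p1)) => //.
  + by move=> h ph mh; apply: IH1 => //; lia.
  + by rewrite perm_sym; apply: perm_map; rewrite perm_rev.
  + by apply: mono_sub mg => y ys; rewrite mem_cat mem_rev ys.
  + exact: mot_leaves m1.
- apply: (relabel_lam (F := Phi_f fuel p2)) => //.
  + by move=> h ph mh; apply: IH2 => //; lia.
  + by apply: mono_sub mg => y ys; rewrite mem_cat ys orbT.
  + exact: mot_leaves m2.
Qed.

Lemma mot_Phi p s t : mot p s t -> perm_eq s (iota 1 (size s)) -> Phi p s = t.
Proof.
move=> m ps; rewrite /Phi -{2}(map_id s) (mot_Phi_f m) ?map_id //.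
exact: relabel_id.
Qed.

(** * From positive paths to marked trees *)

Lemma leaves_setmark t : leaves (setmark t) = leaves t.
Proof. by case: t. Qed.

Lemma pos_leaves p s t : pos p s t -> perm_eq (leaves t) s.
Proof.
elim=> //= [a {}p {}s {}t _ _ IH|{}p {}s {}t m|p1 s1 t1 p2 s2 t2 m1 _ h2 _].
- by rewrite perm_cons.
- by rewrite leaves_setmark (permPl (mot_leaves m)) perm_sym perm_rev.
- by apply: perm_cat => //; rewrite (permPl (mot_leaves m1)) perm_sym perm_rev.
Qed.

Lemma pos_nmarks p s t : pos p s t -> nmarks t = 1.
Proof.
elim=> //= [{}p {}s {}t m|p1 s1 t1 p2 s2 t2 m1 _ -> _].
  by have [a [b e]] := mot_node m; have := mot_nmarks m; rewrite e /= !add0n -addnA => ->.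
by rewrite (mot_nmarks m1).
Qed.

Lemma pos_nonneg p s t : pos p s t -> nonneg_path p.
Proof.
elim=> [a|a {}p {}s {}t _ _ IH|{}p {}s {}t m|p1 s1 t1 p2 s2 t2 m1 _ h2 _].
- by case=> //; rewrite psum0.
- by case=> [|j] /=; rewrite ?psum0 ?psumS ?GRing.add0r //; apply: IH.
- move=> j hj; have [h _] := first_passage_rev (mot_first_passage m).
  by case: j hj => [|j] hj; [rewrite psum0|have := h j.+1 hj; lia].
- apply: nonneg_path_cat => //; last by case: ifP.
  exact: first_passage_rev (mot_first_passage m1).
Qed.

Lemma pos_path_ok p s t : pos p s t -> path_ok p s.
Proof.
elim=> [a|a {}p {}s {}t _ _ h|{}p {}s {}t m|p1 s1 t1 p2 s2 t2 m1 r2 h2 us] //=.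
  exact: path_ok_rev (mot_path_ok m).
rewrite path_ok_cat; last by rewrite size_rev size_revpath (size_mot m1).
rewrite path_ok_rev ?(mot_path_ok m1) // h2 last_rev andbT /=.
(* The labels on the two sides of the cut belong to disjoint words, so they differ and the chosen
   sign is always legal. *)
case: ltngtP => // e; rewrite /edge_ok /= ?e //; exfalso.
have h1 : head 0 s1 \in s1 by apply: head_mem; rewrite (size_mot m1).
have h2' : head 0 s2 \in s2 by apply: head_mem; rewrite (path_ok_size h2).
by move: us; rewrite cat_uniq => /and3P[_ /hasPn/(_ _ h2')]; rewrite -e /= h1.
Qed.

Lemma pos_total p s : nonneg_path p -> path_ok p s -> uniq s ->
  exists t, pos p s t.
Proof.
move: {2}(size p) (leqnn (size p)) => N.
elim: N p s => [|N IH] p s.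
  by case: p s => // [] [|a []] //= _ _ _ _; exists (Lf true a); constructor.
case: p => [|x p].
  by case: s => // a [] //= _ _ _ _; exists (Lf true a); constructor.
case: s => [|a s] // sN fp /andP[he hp] /andP[an us].
have [ex|[ex|ex]] : x = (-1)%R \/ x = 0%R \/ x = 1%R.
  by case/and3P: he => /or3P[]/eqP -> _ _; [left|right; left|right; right].
- by subst x; have := fp 1 isT; rewrite psumS psum0.
- subst x; have [|t ht] := IH p s sN _ hp us.
    by move=> j js; have := fp j.+1 js; rewrite psumS GRing.add0r.
  by exists (Nd false (Lf false a) t); constructor.
have hk : psum (x :: p) 1 = 1%R by rewrite psumS psum0 ex.
have pok : path_ok (x :: p) (a :: s) by rewrite /= he.
have uS : uniq (a :: s) by rewrite /= an.
set P := x :: p in sN fp hk pok *; set S := a :: s in pok uS *.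
have sP : 0 < size P by [].
(* [Q k] says that the first [k] steps form a last passage; the greatest such [k] is one less than
   the index cut by [Phi'], which counts labels. *)
pose Q k := [&& 0 < k <= size P, all (fun j => (1 <= psum P j)%R) (iota 1 k) & psum P k == 1%R].
have hQ : exists k, Q k by exists 1; apply/and3P; split; rewrite /= ?hk.
have bQ k : Q k -> k <= size P by case/andP => /andP[].
case: (ex_maxnP hQ bQ) => k /and3P[/andP[k0 kP] /allP ak /eqP pk] mk.
have ak' j : 0 < j <= k -> (1 <= psum P j)%R by move=> hj; apply: ak; rewrite mem_iota add1n ltnS.
set r := take k P; set S1 := take k.+1 S.
have sr : size r = k by rewrite size_takel.
have hr : last_passage r.
  have e j : j <= k -> psum r j = psum P j.
    by move=> jk; rewrite -[P](cat_take_drop k) psum_catl ?sr.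
  by split=> [j|]; rewrite sr => *; rewrite e ?ak' //; lia.
have sS := path_ok_size pok.
move: (kP); rewrite leq_eqVlt => /predU1P[ekP|kP'].
  (* The last passage is the whole path: the case of a marked root. *)
  have eP : P = revpath (revpath r) by rewrite revpathK /r ekP take_size.
  have [|||t mt] := @mot_total (revpath r) (rev S).
  - exact: last_passage_rev.
  - by rewrite /r ekP take_size; exact: path_ok_rev.
  - by rewrite rev_uniq.
  by exists (setmark t); rewrite eP -(revK S); constructor.
set q := drop k.+1 P; set y := nth 0%R P k.
have EP : P = r ++ y :: q by rewrite -drop_nth // cat_take_drop.
have ES : S = S1 ++ drop k.+1 S by rewrite cat_take_drop.
have sS1 : size S1 = (size r).+1 by rewrite size_takel ?sr ?sS.
have /and3P[o1 o2 o3] : [&& path_ok r S1, edge_ok y (last 0 S1) (head 0 (drop k.+1 S))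
      & path_ok q (drop k.+1 S)].
  by rewrite -path_ok_cat // -EP -ES.
have ek j : psum P (k.+1 + j) = (1 + y + psum q j)%R.
  have -> : k.+1 + j = size r + j.+1 by rewrite sr; lia.
  by rewrite EP psum_catr psumS; case: hr => _ ->; rewrite GRing.addrA.
have sq : size P = k.+1 + size q by rewrite size_drop; lia.
(* A level step would remain at height 1 and give [Q k.+1], against the maximality of [k]. *)
have hy : y = (-1)%R \/ y = 1%R.
  case/and3P: (o2) => /or3P[]/eqP ey _ _; [by left| |by right].
  have pk1 : psum P k.+1 = 1%R by have := ek 0; rewrite addn0 psum0 ey.
  suff Qk : Q k.+1 by have := mk _ Qk; rewrite ltnn.
  apply/and3P; split; rewrite ?pk1 //; apply/allP => j; rewrite mem_iota => hj.
  case: (eqVneq j k.+1) => [->|nj]; first by rewrite pk1.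
  by apply: ak'; lia.
have hq : nonneg_path q.
  case: hy => ey j jq.
    by have := fp (k.+1 + j); rewrite ek ey; lia.
  (* After an up-step from height 1 the path cannot return to height 1, by
     maximality of [k]. *)
  elim: (j : nat) {-2}j (leqnn j) jq => {j} [|M IHM] j jM jq.
    by move: jM; rewrite leqn0 => /eqP ->; rewrite psum0.
  case: j jM jq => [|j] jM jq; first by rewrite psum0.
  have := IHM j jM (ltnW jq) => hj; rewrite psum_nth //.
  have /allP/(_ _ (mem_nth 0%R jq)) st := path_ok_steps o3.
  have st' : (-1 <= nth 0 q j)%R by case/or3P: st => /eqP ->.
  case neg : (0 <= psum q j + nth 0 q j)%R => //; exfalso.
  have e1 : (psum q j.+1 = -1)%R by rewrite psum_nth //; lia.
  suff Qk : Q (k.+1 + j.+1) by have := mk _ Qk; lia.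
  apply/and3P; split; first by rewrite sq leq_add2l.
    2: by rewrite ek e1 ey.
  apply/allP => i; rewrite mem_iota => hi; case: (leqP i k) => ik; first by apply: ak'; lia.
  have -> : i = k.+1 + (i - k.+1) by lia.
  rewrite ek ey; case: (eqVneq (i - k.+1) j.+1) => [->|ni]; first by rewrite e1.
  by have := IHM (i - k.+1); lia.
have [u1 _ u2] := and3P (etrans (esym (cat_uniq _ _)) (etrans (congr1 uniq (esym ES)) uS)).
have [|||t1 m1] := @mot_total (revpath r) (rev S1).
- exact: last_passage_rev.
- exact: path_ok_rev.
- by rewrite rev_uniq.
have [||||t2 m2] := IH q (drop k.+1 S) => //; first by lia.
exists (Nd false t1 t2).
have um : uniq (rev S1 ++ drop k.+1 S) by rewrite uniq_rev_cat -ES.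
have := pos_sub m1 m2 um; rewrite revpathK revK -ES -last_rev revK.
(* [o2] compares the labels on both sides of [y], and the sign of a nonzero step is determined by
   that comparison. *)
have -> : (if last 0 S1 < head 0 (drop k.+1 S) then (-1)%R else 1%R) = y.
  by case/and3P: o2 => _; case: hy => -> /=; [move=> ->|case: ltngtP].
by rewrite -EP.
Qed.

Lemma teq_setmark_inv t t' : rootmark t = rootmark t' -> teq (setmark t) (setmark t') -> teq t t'.
Proof.
by case: t t' => [m x|m a b] [m' y|m' a' b'] /= -> T; inversion T; constructor.
Qed.

(** The root mark isolates [pos_root]. Elsewhere exactly one child contains the mark, so an
    equivalence cannot exchange the two children, and the unmarked child, leaf or internal, tells
    which rule was used. *)
Lemma pos_teq_inj p s t p' s' t' : pos p s t -> pos p' s' t' -> teq t t' ->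
  p = p' /\ s = s'.
Proof.
have bad a (u : seq int) v w : pos u v w -> ~ teq (Lf false a) w.
  by move=> /pos_nmarks e /teq_nmarks; rewrite e.
have badr a (u : seq int) v w : pos u v w -> ~ teq w (Lf false a).
  by move=> /pos_nmarks e /teq_nmarks; rewrite e.
have badm (u : seq int) v w u' v' w' : mot u v w -> pos u' v' w' -> ~ teq w w'.
  by move=> /mot_nmarks e /pos_nmarks e' /teq_nmarks; rewrite e e'.
have badn a (u : seq int) v w : mot u v w -> ~ teq (Lf false a) w.
  by move=> /mot_node[? [? ->]] T; inversion T.
have badnr a (u : seq int) v w : mot u v w -> ~ teq w (Lf false a).
  by move=> /mot_node[? [? ->]] T; inversion T.
move=> m; elim: m p' s' t' => [a|a {}p {}s {}t _ mt IH|{}p {}s {}t mt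
  |p1 s1 t1 p2 s2 t2 m1 m2 IH2 _] p' s' t'.
- move=> m'; case: m' => [a'|a' q u v _ mv|q u v mv|q1 u1 v1 q2 u2 v2 n1 n2 _] T; try by inversion T.
  by have [? [? e]] := mot_node mv; move: T; rewrite e => T; inversion T.
- move=> m'; case: m' => [a'|a' q u v _ mv|q u v mv|q1 u1 v1 q2 u2 v2 n1 n2 _] T.
  + by inversion T.
  + inversion T as [|? ? ? ? ? T1 T2|? ? ? ? ? T1 T2]; subst.
      by have [-> ->] := IH _ _ _ mv T2; inversion T1.
    by case: (bad _ _ _ _ mv T1).
  + by have := teq_rootmark T; have [? [? ->]] := mot_node mv.
  + inversion T as [|? ? ? ? ? T1 T2|? ? ? ? ? T1 T2]; subst.
      by case: (badn _ _ _ _ n1 T1).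
    by case: (bad _ _ _ _ n2 T1).
- have [a [b e]] := mot_node mt.
  move=> m'; case: m' => [a'|a' q u v _ mv|q u v mv|q1 u1 v1 q2 u2 v2 n1 n2 _] T.
  + by move: T; rewrite e => T; inversion T.
  + by have := teq_rootmark T; rewrite e.
  + have T' : teq t v.
      by apply: teq_setmark_inv T; have [? [? ->]] := mot_node mv; rewrite e.
    by have [-> ->] := mot_teq_inj mt mv T'.
  + by have := teq_rootmark T; rewrite e.
- move=> m'; case: m' => [a'|a' q u v _ mv|q u v mv|q1 u1 v1 q2 u2 v2 n1 n2 _] T.
  + by inversion T.
  + inversion T as [|? ? ? ? ? T1 T2|? ? ? ? ? T1 T2]; subst.
      by case: (badnr _ _ _ _ m1 T1).
    by case: (badr _ _ _ _ m2 T2).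
  + by have := teq_rootmark T; have [? [? ->]] := mot_node mv.
  + inversion T as [|? ? ? ? ? T1 T2|? ? ? ? ? T1 T2]; subst.
      by have [-> ->] := mot_teq_inj m1 n1 T1; have [-> ->] := IH2 _ _ _ n2 T2.
    by case: (badm _ _ _ _ _ _ m1 n2 T1).
Qed.

Lemma teq_setmark t t' : teq t t' -> teq (setmark t) (setmark t').
Proof. by case=> *; constructor. Qed.

Lemma teq_swapl m a b t : teq (Nd m a b) t -> teq (Nd m b a) t.
Proof.
by move=> T; inversion T; subst; [apply: teq_swap|apply: teq_node].
Qed.

(** The rules of [pos] put the unmarked child first; it is a level step if it is a leaf and a
    reversed Motzkin path otherwise. *)
Lemma pos_surj_node a b p s b' : nmarks a = 0 -> uniq (leaves a ++ leaves b) ->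
  pos p s b' -> teq b b' ->
  exists p1 s1 t1, pos p1 s1 t1 /\ teq (Nd false a b) t1.
Proof.
rewrite cat_uniq => ma /and3P[ua /hasPn hab ub] pb tb.
have lb := perm_trans (teq_leaves tb) (pos_leaves pb).
case E : a ma ua hab => [m x|m a1 a2] ma ua hab.
  case: m {E} ma ua hab => // _ _ hab.
  exists (0%R :: p), (x :: s), (Nd false (Lf false x) b'); split.
    by constructor=> //; rewrite -(perm_mem lb); apply/negP => /hab; rewrite inE eqxx.
  by apply: teq_node => //; apply: teq_refl.
rewrite -E in ma ua hab *.
have [|p1 [s1 [a' [mt ta]]]] := mot_surj ma ua.
  by rewrite E /= size_cat; have := leaves_gt0 a1; have := leaves_gt0 a2; lia.
have la := perm_trans (teq_leaves ta) (mot_leaves mt).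
do 3 eexists; split; last exact: (teq_node false ta tb).
apply: pos_sub mt pb _; rewrite -(perm_uniq (perm_cat la lb)) cat_uniq ua ub andbT.
exact/hasPn.
Qed.

Lemma pos_surj t : nmarks t = 1 -> uniq (leaves t) ->
  exists p s t', pos p s t' /\ teq t t'.
Proof.
elim: t => [[] l|m a IHa b IHb] //.
  by exists [::], [:: l], (Lf true l); split; [constructor|apply: teq_refl].
rewrite [nmarks _]/= [leaves _]/= => nm u.
case: m nm => nm.
  have [||p [s [t' [mt T]]]] := @mot_surj (Nd false a b) _ u.
  - by rewrite /=; lia.
  - by rewrite /= size_cat; have := leaves_gt0 a; have := leaves_gt0 b; lia.
  exists (revpath p), (rev s), (setmark t'); split; first by constructor.
  exact: (teq_setmark T).
have [ua _ ub] := and3P (etrans (esym (cat_uniq _ _)) u).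
have [[ma mb]|[ma mb]] : nmarks a = 0 /\ nmarks b = 1 \/ nmarks a = 1 /\ nmarks b = 0 by lia.
  have [p [s [b' [pb tb]]]] := IHb mb ub.
  exact: pos_surj_node ma u pb tb.
have [p [s [a' [pa ta]]]] := IHa ma ua.
rewrite uniq_catC in u; have [p1 [s1 [t1 [h1 h2]]]] := pos_surj_node mb u pa ta.
by exists p1, s1, t1; split=> //; apply: teq_swapl.
Qed.

Lemma size_pos p s t : pos p s t -> size s = (size p).+1.
Proof. by move/pos_path_ok/path_ok_size. Qed.

Lemma pos_Phi'_f p s t fuel g : pos p s t -> size s <= fuel ->
  perm_eq (map g s) (iota 1 (size s)) -> {in s &, {mono g : x y / x < y}} ->
  Phi'_f fuel p (map g s) = relabel g t.
Proof.
(* Keeping positivity of the fuel as a premise disposes of the case without fuel for all four rules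
   at once. *)
move=> m sf; have : 0 < fuel by apply: leq_trans sf; rewrite (size_pos m).
elim: m fuel g sf => [a|a {}p {}s {}t an mt IH|{}p {}s {}t mt
  |p1 s1 t1 p2 s2 t2 m1 m2 IH2 us] [|fuel] g //.
- by move=> _ _ /perm_mem/(_ (g a)) + _ /=; rewrite !inE eqxx => /esym/eqP ->.
- rewrite /= ltnS => sf _ pg mg; have ss := size_pos mt.
  rewrite size_map (_ : (size s < 1) = false); [congr Nd|by rewrite ss].
  have pJ : perm_eq (map g s) (rem (g a) (1 :: iota 2 (size s))).
    rewrite -(perm_cons (g a)) (permPl pg); apply: perm_to_rem.
    by rewrite -(perm_mem pg) mem_head.
  apply: (relabel_lam (F := Phi'_f fuel p)) => //.
  + by move=> h ph mh; apply: IH => //; apply: leq_trans sf; rewrite ss.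
  + exact: (rem_uniq (g a) (iota_uniq 1 (size s).+1)).
  + by apply: mono_sub mg => x xs; rewrite inE xs orbT.
  + exact: pos_leaves mt.
- rewrite size_rev => sf _ pg mg; have s2 := mot_size mt.
  have lr := first_passage_rev (mot_first_passage mt).
  have sr : (size (revpath p)).+1 = size s by rewrite size_revpath (size_mot mt).
  rewrite /= size_map size_rev leqNgt s2 /=.
  case Ep : (revpath p) => [|x q]; first by rewrite Ep in sr; rewrite -sr in s2.
  rewrite (last_passage_head lr (p := [::]) (x := x) (q := q)) ?cats0 // -Ep.
  have ek := kmax_full lr; rewrite sr in ek; rewrite ek eqxx.
  have -> : (size s).-1 = size (revpath p) by rewrite -sr.
  rewrite take_size -/(revpath (revpath p)) revpathK take_oversize; last by rewrite size_map size_rev.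
  rewrite -map_rev revK.
  have -> : map (laminv (map g (rev s))) (map g s) = map g s.
    rewrite -[RHS]map_id; apply/eq_in_map => y ys; apply: (laminv_iota pg).
    by rewrite map_rev mem_rev.
  rewrite relabel_setmark; congr setmark; rewrite /Phi size_map.
  apply: (mot_Phi_f mt) => //.
    by rewrite -(permPr pg); rewrite map_rev perm_sym perm_rev.
  by apply: mono_sub mg => y; rewrite mem_rev.
rewrite size_cat size_rev => sf _ pg mg.
have z1 := mot_size m1; have z2 := size_pos m2.
have lr := first_passage_rev (mot_first_passage m1).
have sr : (size (revpath p1)).+1 = size s1 by rewrite size_revpath (size_mot m1).
have ug : uniq (map g (rev s1 ++ s2)) by rewrite (perm_uniq pg) iota_uniq.
set y := (if _ < _ then _ else _).
have hy : y = (-1)%R \/ y = 1%R by rewrite /y; case: ifP; [left|right].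
have ek := kmax_cat lr hy (pos_nonneg m2).
rewrite /= size_map size_cat size_rev leqNgt (_ : 1 < size s1 + size s2) //=; last by lia.
have sn : (size (revpath p1 ++ y :: p2)).+1 = size s1 + size s2.
  by rewrite size_cat /= z2 -sr; lia.
rewrite sn in ek.
case Ep : (revpath p1 ++ y :: p2) => [|x q]; first by case: (revpath p1) Ep.
rewrite (last_passage_head lr Ep) -Ep ek sr map_cat.
rewrite ifF; last by apply/eqP; lia.
rewrite take_size_cat ?size_map ?size_rev // drop_size_cat ?size_map ?size_rev //.
have -> : take (size s1).-1 (revpath p1 ++ y :: p2) = revpath p1.
  by rewrite -sr take_size_cat.
have -> : drop (size s1) (revpath p1 ++ y :: p2) = p2.
  by rewrite -sr -cat_rcons drop_size_cat // size_rcons.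
rewrite -/(revpath (revpath p1)) revpathK -map_rev revK.
move: ug; rewrite map_cat cat_uniq => /and3P[u1 _ u2].
congr Nd.
- apply: (relabel_lam (F := Phi p1)) => //.
  + by move=> h ph mh; apply: (mot_Phi_f m1) => //; rewrite size_map.
  + by rewrite perm_sym; apply: perm_map; rewrite perm_rev.
  + by apply: mono_sub mg => x' xs; rewrite mem_cat mem_rev xs.
  + exact: mot_leaves m1.
- apply: (relabel_lam (F := Phi'_f fuel p2)) => //.
  + by move=> h ph mh; apply: IH2 => //; lia.
  + by apply: mono_sub mg => x' xs; rewrite mem_cat xs orbT.
  + exact: pos_leaves m2.
Qed.

Lemma pos_Phi' p s t : pos p s t -> perm_eq s (iota 1 (size s)) -> Phi' p s = t.
Proof.
move=> m ps; rewrite /Phi' -{2}(map_id s) (pos_Phi'_f m) ?map_id //.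
exact: relabel_id.
Qed.

(** * Well-labelled paths and the two bijections *)

Lemma motzkinE n p : size p = n.-1 -> 2 <= n -> motzkin n p <-> first_passage p.
Proof.
move=> sp n2; split=> [/andP[/allP h1 /eqP h2]|[h1 h2]].
  split; last by rewrite sp.
  by case=> [|j] hj; [rewrite psum0|apply: h1; rewrite mem_iota; lia].
apply/andP; split; last by rewrite -sp h2.
by apply/allP => j; rewrite mem_iota => hj; apply: h1; lia.
Qed.

Lemma positive_pathE n p : size p = n.-1 -> positive_path n p <-> nonneg_path p.
Proof.
move=> sp; split=> [/allP h1 [|j] hj|h1]; first by rewrite psum0.
  by apply: h1; rewrite mem_iota; lia.
by apply/allP => j; rewrite mem_iota => hj; apply: h1; lia.
Qed.

Lemma wl_motzkin_mot n x : 2 <= n -> wl_motzkin n x ->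
  exists t, [/\ mot x.1 x.2 t, Phi x.1 x.2 = t, valid n t & nmarks t = 0].
Proof.
case: x => p s n2 [/= wl mz]; have n0 := ltnW n2.
move: (wl); rewrite well_labelledE // => /andP[po ps].
have ss : size s = n by rewrite (perm_size ps) size_iota.
have sp : size p = n.-1 by rewrite -ss (path_ok_size po).
have [|t mt] := mot_total ((motzkinE sp n2).1 mz) po; first by rewrite (perm_uniq ps) iota_uniq.
exists t; split=> //.
- by apply: mot_Phi => //; rewrite ss.
- by rewrite /valid (permPl (mot_leaves mt)).
- exact: mot_nmarks mt.
Qed.

Lemma wl_positive_pos n x : 1 <= n -> wl_positive n x ->
  exists t, [/\ pos x.1 x.2 t, Phi' x.1 x.2 = t, valid n t & nmarks t = 1].
Proof.
case: x => p s n0 [/= wl mz].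
move: (wl); rewrite well_labelledE // => /andP[po ps].
have ss : size s = n by rewrite (perm_size ps) size_iota.
have sp : size p = n.-1 by rewrite -ss (path_ok_size po).
have [|t mt] := pos_total ((positive_pathE sp).1 mz) po; first by rewrite (perm_uniq ps) iota_uniq.
exists t; split=> //.
- by apply: pos_Phi' => //; rewrite ss.
- by rewrite /valid (permPl (pos_leaves mt)).
- exact: pos_nmarks mt.
Qed.

Theorem theorem3 :
  (forall n : nat, (2 <= n)%N ->
     bij_between (wl_motzkin n) (fun f => is_matching f) (PsiPhi n)) /\
  (forall n : nat, (1 <= n)%N ->
     bij_between (wl_positive n) (fun f => is_matching f) (Psi'Phi' n)).
Proof.
split=> n hn; split.
- move=> x /(wl_motzkin_mot hn)[t [_ et vt _]].
  by rewrite /PsiPhi et; apply: Psi_matching.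
- move=> x y /(wl_motzkin_mot hn)[t [mt et vt nt]] /(wl_motzkin_mot hn)[u [mu eu vu nu]].
  rewrite /PsiPhi et eu => /(Psi_inj hn vt vu nt nu) /(mot_teq_inj mt mu)[].
  by case: x {mt et} => ? ?; case: y {mu eu} => ? ? /= -> ->.
- move=> f /(Psi_surj hn)[t [vt nt ft]].
  have st : size (leaves t) = n by rewrite (perm_size vt) size_iota.
  have [||p [s [t' [mt tt']]]] := mot_surj nt; first by rewrite (perm_uniq vt) iota_uniq.
    by rewrite st.
  have ps : perm_eq s (iota 1 n).
    by rewrite -(permPl (mot_leaves mt)) -(permPl (teq_leaves tt')).
  have ss : size s = n by rewrite (perm_size ps) size_iota.
  have sp : size p = n.-1 by rewrite -ss (size_mot mt).
  exists (p, s).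
    split; first by rewrite well_labelledE ?(ltnW hn) // (mot_path_ok mt).
    by apply/(motzkinE sp hn); exact: mot_first_passage mt.
  (* The path yields [t'] rather than [t], but the matching does not depend on the order of
     siblings. *)
  by rewrite /PsiPhi /= (mot_Phi mt) ?ss // -(Psi_teq hn vt nt tt').
- move=> x /(wl_positive_pos hn)[t [_ et vt nt]].
  by rewrite /Psi'Phi' et; apply: Psi'_matching.
- move=> x y /(wl_positive_pos hn)[t [mt et vt nt]] /(wl_positive_pos hn)[u [mu eu vu nu]].
  rewrite /Psi'Phi' et eu => /(Psi'_inj hn vt vu nt nu) /(pos_teq_inj mt mu)[].
  by case: x {mt et} => ? ?; case: y {mu eu} => ? ? /= -> ->.
- move=> f /(Psi'_surj hn)[t [vt nt ft]].
  have [|p [s [t' [mt tt']]]] := pos_surj nt; first by rewrite (perm_uniq vt) iota_uniq.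
  have ps : perm_eq s (iota 1 n).
    by rewrite -(permPl (pos_leaves mt)) -(permPl (teq_leaves tt')).
  have ss : size s = n by rewrite (perm_size ps) size_iota.
  have sp : size p = n.-1 by rewrite -ss (size_pos mt).
  exists (p, s).
    split; first by rewrite well_labelledE // (pos_path_ok mt).
    by apply/(positive_pathE sp); exact: pos_nonneg mt.
  by rewrite /Psi'Phi' /= (pos_Phi' mt) ?ss // -(Psi'_teq hn vt nt tt').
Qed.
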